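(* Assume all standing assumptions (A1)–(A7) listed in the context (with $c$ the constant of (A6)), and let $c_0=c$. Fix $l_2\in(0,1)$. Let $\{\sigma_l\}_{l\ge1}\subset(0,1)$ with $\sigma_l\to0$, let $\{J_l\}_{l\ge1}$ be positive integers with $J_l\to\infty$, and for each $l$ let $\tau_l>0$ and positive integers $T_l,K_l$ satisfy $$\tau_l\le\frac{c\,\sigma_l^2}{36HJ_lL_0\bar l(J_l)},\qquad T_l\ge\frac{9M_3\bar l(J_l)}{\sigma_l^2},\qquad K_l\ge\frac{2\ln\big(\sigma_l^2/(36M\bar l(J_l)^2)\big)}{\ln(1-\mu/L_G)}.$$ For each $l$, run Procedure P (defined in the context) with $\tau=\tau_l$, $J=J_l$, $T=T_l$, $K=K_l$ and stepsizes $\alpha=1/L_1$, $\beta=1/L_G$, $\eta=1/(L_\varphi(J_l)/2+l_2)$, and let $(x_l,y_l)$ be the $\sigma_l$-FNE point generated by it, i.e. $(x_l,y_l)=(x_{t},z_{K_l}(x_{t}))$, for some $t\in\{0,\dots,T_l-1\}$, is a $\sigma_l$-FNE point of $\min_{x\in\mathcal X}\max_{y\in\mathcal Y}G_{\epsilon,\tau_l,J_l}(x,y)$. If $(\bar x,\bar y)$ is an accumulation point of the sequence $\{(x_l,y_l)\}_{l\ge1}$ with $\bar x$ an interior point of $\mathcal X$, then $\bar x$ is a stationary point of the problem PBP$\epsilon$.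
   Context: Fix $\epsilon>0$. $\|\cdot\|$ is the Euclidean norm for vectors and the spectral norm for matrices. (A1) $\mathcal X\subset\mathbb R^n$, $\mathcal Y\subset\mathbb R^m$ are nonempty, convex, closed, and there are $H>0$, $M>1$ with $\|x\|\le H$ on $\mathcal X$, $\|y\|\le M$ on $\mathcal Y$. (A2) $\mathcal C\subset\mathbb R^n$ is open, convex and contains $\mathcal X$; $F,f:\mathcal C\times\mathcal Y\to\mathbb R$ are twice continuously differentiable; for each $x\in\mathcal X$, $F(x,\cdot)$ is $\mu$-strongly concave on $\mathcal Y$ ($\mu>0$); $f$ is convex on $\mathcal C\times\mathcal Y$. (A3) On $\mathcal X\times\mathcal Y$: $F$ and $f$ are $h_0$- and $L_0$-Lipschitz; $\nabla F$ and $\nabla f$ are $h_1$- and $L_1$-Lipschitz; $\nabla_{yx}f:=\nabla_x(\nabla_yf)$ and $\nabla_{yy}f:=\nabla_y(\nabla_y f)$ are $L_2$- and $L_3$-Lipschitz. Let $f^*(x)=\min_{y\in\mathcal Y}f(x,y)$, $\mathcal S_\epsilon(x)=\{y\in\mathcal Y:f(x,y)\le f^*(x)+\epsilon\}$, $\mathcal R_\epsilon(x)=\arg\max_{y\in\mathcal S_\epsilon(x)}F(x,y)$. PBP$\epsilon$ is the problem $\min_{x\in\mathcal X}\varphi_\epsilon(x)$, $\varphi_\epsilon(x)=\max_{y\in\mathcal S_\epsilon(x)}F(x,y)$. Under (A1), (A2), $f^*$ is differentiable on $\mathcal X$ with $\nabla f^*(x)=\nabla_xf(x,y_1^* )$ for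 any $y_1^*\in\arg\min_{y\in\mathcal Y}f(x,y)$. (A4) All local optimal solutions of PBP$\epsilon$ (points $\bar x\in\mathcal X$ with $\varphi_\epsilon(\bar x)\le\varphi_\epsilon(x)$ for all $x\in\mathcal X$ in a neighbourhood of $\bar x$) are interior points of $\mathcal X$. Lower-level gradient steps: for $x\in\mathcal X$, starting from $y_0(x)\in\mathcal Y$, $y_{j+1}(x)=\mathrm{proj}_{\mathcal Y}(y_j(x)-\alpha\nabla_yf(x,y_j(x)))$, $j=0,\dots,J-1$; $f_J(x):=f(x,y_J(x))$. (A5) $\alpha=1/L_1$; $y_0(x)=y_0\in\mathcal Y$ for all $x\in\mathcal X$; and for any $x\in\mathcal X$, $y_0\in\mathcal Y$ and positive integer $J$ the projections are inactive: $y_{j+1}(x)=y_j(x)-\alpha\nabla_yf(x,y_j(x))$, $j=0,\dots,J-1$. (Then $f_J$ is differentiable on $\mathcal X$.) For $\tau\in(0,1)$ and positive integer $J$ let $$G_{\epsilon,\tau,J}(x,y)=F(x,y)+\tau\ln\big(f_J(x)+\epsilon-f(x,y)\big),$$ with value $-\infty$ where the argument of $\ln$ is not positive. (A6) There is $c>0$, $c\le\min\{\epsilon/2,L_0H,1\}$, such that for all $\tau\in(0,1)$, positive integers $J$, $x\in\mathcal X$, at least one global maximizer of $G_{\epsilon,\tau,J}(x,\cdot)$ over $\mathcal Y$ lies in $\mathcal Y_J:=\bigcap_{z\in\mathcal X}\{y\in\mathcal Y:f_J(z)+\epsilon-f(z,y)\ge c\}$. With $c_0=c$, let $\mathcal Y_J(x):=\{y\in\mathcal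 Y:f_J(x)+\epsilon-f(x,y)\ge c_0/2\}$. (A7) For all $\tau\in(0,1)$, positive integers $J$, $x\in\mathcal X$, the point $y^*(x):=\arg\max_{y\in\mathcal Y_J(x)}G_{\epsilon,\tau,J}(x,y)$ is an interior point of $\mathcal Y$. Constants: $M_1(J)=L_0(J+1)$; $M_2(J)=L_1(1+J)^2+\frac{L_0J}{L_1}(1+J)(L_2+L_3J)$; $L_{11}(J)=h_1+\frac1c(M_2(J)+L_1)+\frac1{c^2}(M_1(J)+L_0)^2$; $L_{12}(J)=h_1+\frac1cL_1+\frac1{c^2}L_0(M_1(J)+L_0)$; $L_G=h_1+\frac2cL_1+\frac4{c^2}L_0^2$; $L_\varphi(J)=L_{11}(J)\big(1+\frac1\mu L_{12}(J)\big)$; $M_3=\max\{|\min_{\mathcal X\times\mathcal Y}F+\ln c|,\ |\max_{\mathcal X\times\mathcal Y}F+\ln(2\max_{\mathcal X\times\mathcal Y}|f|+\epsilon)|\}$; $l_1(J)=\max\{1,L_{11}(J)H,L_G\}$; $$\bar l(J)=\max\Big\{\frac{\big(2H(L_\varphi(J)/2+l_2)+h_0+\frac4cL_0\big)^2}{l_2},\ l_1(J)\Big\}.$$ A point $(\bar x,\bar y)\in\mathcal X\times\mathcal Y$ with $f_J(\bar x)+\epsilon-f(\bar x,\bar y)>0$ is a $\sigma$-first order Nash equilibrium ($\sigma$-FNE) point of $\min_{x\in\mathcal X}\max_{y\in\mathcal Y}G_{\epsilon,\tau,J}(x,y)$ if $\langle\nabla_xG_{\epsilon,\tau,J}(\bar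 x,\bar y),x-\bar x\rangle\ge-\sigma$ for all $x\in\mathcal X$ and $\|\nabla_yG_{\epsilon,\tau,J}(\bar x,\bar y)\|\le\sigma$. Procedure P (given $\tau,J,T,K$, $\alpha,\beta,\eta$, $x_0\in\mathcal X$): for $t=0,\dots,T-1$: compute $y_J(x_t)$ by the lower-level gradient steps with stepsize $\alpha$, and $f_J(x_t)$; choose $z_0(x_t)\in\mathcal Y_J(x_t)$ and for $k=0,\dots,K-1$ set $z_{k+1}(x_t)=\mathrm{proj}_{\mathcal Y_J(x_t)}\big(z_k(x_t)+\beta\nabla_yG_{\epsilon,\tau,J}(x_t,z_k(x_t))\big)$; set $x_{t+1}=\mathrm{proj}_{\mathcal X}(x_t-\eta a_t)$ with $$a_t=\nabla_xF(x_t,z_K(x_t))+\frac{\tau}{f_J(x_t)+\epsilon-f(x_t,z_K(x_t))}\big(\nabla_xf(x_t,y_J(x_t))-\nabla_xf(x_t,z_K(x_t))\big).$$ Stationary point: with $\mathcal N_{\mathcal Y}(y)=\{v:\langle v,y'-y\rangle\le0\ \forall y'\in\mathcal Y\}$, a point $\bar x\in\mathcal X$ is a stationary point of PBP$\epsilon$ if there exist $\bar y\in\mathcal R_\epsilon(\bar x)$, $\lambda_1\in\{0,1\}$, $\lambda_2\ge0$, $\lambda_3\ge0$ not all zero, integers $I,J$, $r_{ij}\ge0$ with $\sum_{i=1}^I\sum_{j=1}^Jr_{ij}=1$, $y_i\in\mathcal R_\epsilon(\bar x)$, $\sigma_{ij}\ge0$ ($1\le i\le I$, $1\le j\le J$)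 such that, with $e_{ij}=\nabla_xF(\bar x,y_i)-\sigma_{ij}(\nabla_xf(\bar x,y_i)-\nabla f^*(\bar x))$: $0=\lambda_1\nabla_xF(\bar x,\bar y)+\lambda_2(\sum_{i,j}r_{ij}e_{ij}-\nabla_xF(\bar x,\bar y))+\lambda_3(\nabla_xf(\bar x,\bar y)-\nabla f^*(\bar x))$; $0\in\lambda_1\nabla_yF(\bar x,\bar y)-\lambda_2\nabla_yF(\bar x,\bar y)+\lambda_3\nabla_yf(\bar x,\bar y)+\mathcal N_{\mathcal Y}(\bar y)$; $\lambda_3(f(\bar x,\bar y)-f^*(\bar x)-\epsilon)=0$; and for all $i,j$: $\sigma_{ij}(f(\bar x,y_i)-f^*(\bar x)-\epsilon)=0$ and $0\in-\nabla_yF(\bar x,y_i)+\sigma_{ij}\nabla_yf(\bar x,y_i)+\mathcal N_{\mathcal Y}(y_i)$. *)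

(* Defs.v *)
From HB Require Import structures.
From mathcomp Require Import all_boot all_order all_algebra.
From mathcomp Require Import all_classical all_reals all_analysis.

Set Implicit Arguments.
Unset Strict Implicit.
Unset Printing Implicit Defensive.

Import Order.TTheory GRing.Theory Num.Theory.
Import numFieldNormedType.Exports.

Local Open Scope classical_set_scope.
Local Open Scope ring_scope.

Section euclidean.
Context {R : realType}.

Definition dot {p} (u v : 'rV[R]_p) : R := \sum_i u ord0 i * v ord0 i.

(* The library norm on 'rV[R]_p is the sup norm; it induces the same topology
   as the Euclidean norm, so nbhs, interior, cluster, etc. are the library's. *)
Definition enorm {p} (u : 'rV[R]_p) : R := Num.sqrt (dot u u).

Definition spectral_norm {p q} (A : 'M[R]_(p, q)) : R :=
  sup [set enorm (v *m A) | v in [set v : 'rV[R]_p | enorm v <= 1]].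

Definition lipschitz {p} {W : zmodType} (nrm : W -> R)
    (S : set 'rV[R]_p) (L : R) (g : 'rV[R]_p -> W) : Prop :=
  0 <= L /\
  forall z z', S z -> S z' -> nrm (g z - g z') <= L * enorm (z - z').

Definition is_eproj {p} (S : set 'rV[R]_p) (z w : 'rV[R]_p) : Prop :=
  S w /\ forall w', S w' -> enorm (z - w) <= enorm (z - w').

(* Euclidean projection; unique for nonempty closed convex sets. *)
Definition eproj {p} (S : set 'rV[R]_p) (z : 'rV[R]_p) : 'rV[R]_p :=
  get (is_eproj S z).

(* Derivatives are relative to a set S, i.e. the increments stay in S. On an
   open S this is Frechet differentiability. It also makes sense at the boundary
   points of a convex set with nonempty interior, where the gradient is still
   unique; this is how derivatives on closed feasible sets are understood. *)
Definition is_grad {p} (S : set 'rV[R]_p) (g : 'rV[R]_p -> R)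
    (z v : 'rV[R]_p) : Prop :=
  forall e : R, 0 < e -> \forall z' \near z, S z' ->
    `|g z' - g z - dot v (z' - z)| <= e * enorm (z' - z).

Definition is_jac {p q} (S : set 'rV[R]_p) (g : 'rV[R]_p -> 'rV[R]_q)
    (z : 'rV[R]_p) (A : 'M[R]_(p, q)) : Prop :=
  forall e : R, 0 < e -> \forall z' \near z, S z' ->
    enorm (g z' - g z - (z' - z) *m A) <= e * enorm (z' - z).

Definition grad {p} (S : set 'rV[R]_p) (g : 'rV[R]_p -> R) (z : 'rV[R]_p) :
  'rV[R]_p := get (is_grad S g z).

(* As for the library's jacobian, the matrix acts on row vectors from the right;
   it is thus the transpose of the column-vector Jacobian, with the same
   spectral norm. *)
Definition jac {p q} (S : set 'rV[R]_p) (g : 'rV[R]_p -> 'rV[R]_q)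
    (z : 'rV[R]_p) : 'M[R]_(p, q) := get (is_jac S g z).

Definition twice_cont_diff {p} (S : set 'rV[R]_p) (g : 'rV[R]_p -> R) : Prop :=
  exists (dg : 'rV[R]_p -> 'rV[R]_p) (d2g : 'rV[R]_p -> 'M[R]_p),
    [/\ forall z, S z -> is_grad S g z (dg z),
        forall z, S z -> is_jac S dg z (d2g z) &
        {within S, continuous d2g}].

Definition strongly_concave {p} (mu : R) (S : set 'rV[R]_p)
    (g : 'rV[R]_p -> R) : Prop :=
  forall y y' (t : R), S y -> S y' -> 0 <= t <= 1 ->
    t * g y + (1 - t) * g y' + mu / 2 * t * (1 - t) * enorm (y - y') ^+ 2
    <= g (t *: y + (1 - t) *: y').

Definition normal_cone {p} (S : set 'rV[R]_p) (y : 'rV[R]_p) :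
  set 'rV[R]_p := [set v | forall y', S y' -> dot v (y' - y) <= 0].

Definition prod_set {n m} (A : set 'rV[R]_n) (B : set 'rV[R]_m) :
  set 'rV[R]_(n + m) := [set z | A (lsubmx z) /\ B (rsubmx z)].

Definition joint {n m} {T : Type} (g : 'rV[R]_n -> 'rV[R]_m -> T)
    (z : 'rV[R]_(n + m)) : T := g (lsubmx z) (rsubmx z).

End euclidean.

Record bilevel (R : realType) (n m : nat) := Bilevel {
  feasX : set 'rV[R]_n;
  domC  : set 'rV[R]_n;
  feasY : set 'rV[R]_m;
  upper : 'rV[R]_n -> 'rV[R]_m -> R;   (* F *)
  lower : 'rV[R]_n -> 'rV[R]_m -> R;   (* f *)
  eps   : R;
  boundX : R;                          (* H *)
  boundY : R;                          (* M *)
  mu    : R;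
  h0 : R; h1 : R;
  L0 : R; L1 : R; L2 : R; L3 : R;
  alpha : R;
  y0    : 'rV[R]_m;
  cslack : R                           (* c *)
}.

Section bilevel_problem.
Context {R : realType} {n m : nat}.
Variable P : bilevel R n m.

Local Notation X := (feasX P).
Local Notation C := (domC P).
Local Notation Y := (feasY P).
Local Notation F := (upper P).
Local Notation f := (lower P).
Local Notation H := (boundX P).
Local Notation M := (boundY P).
Local Notation c := (cslack P).

Definition dx (g : 'rV[R]_n -> 'rV[R]_m -> R) (x : 'rV[R]_n) (y : 'rV[R]_m) :
  'rV[R]_n := grad C (fun x' => g x' y) x.

Definition dy (g : 'rV[R]_n -> 'rV[R]_m -> R) (x : 'rV[R]_n) (y : 'rV[R]_m) :
  'rV[R]_m := grad Y (g x) y.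

Definition dyx (g : 'rV[R]_n -> 'rV[R]_m -> R) (x : 'rV[R]_n) (y : 'rV[R]_m) :
  'M[R]_(n, m) := jac C (fun x' => dy g x' y) x.

Definition dyy (g : 'rV[R]_n -> 'rV[R]_m -> R) (x : 'rV[R]_n) (y : 'rV[R]_m) :
  'M[R]_(m, m) := jac Y (dy g x) y.

Definition fstar (x : 'rV[R]_n) : R := inf [set f x y | y in Y].

Definition Seps (x : 'rV[R]_n) : set 'rV[R]_m :=
  [set y | Y y /\ f x y <= fstar x + eps P].

Definition Reps (x : 'rV[R]_n) : set 'rV[R]_m :=
  [set y | Seps x y /\ forall y', Seps x y' -> F x y' <= F x y].

Definition phi (x : 'rV[R]_n) : R := sup [set F x y | y in Seps x].

Definition local_solution (x : 'rV[R]_n) : Prop :=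
  X x /\ \forall x' \near x, X x' -> phi x <= phi x'.

Fixpoint lower_iter (y : 'rV[R]_m) (x : 'rV[R]_n) (j : nat) : 'rV[R]_m :=
  if j is j'.+1 then
    eproj Y (lower_iter y x j' - alpha P *: dy f x (lower_iter y x j'))
  else y.

Definition yJ (J : nat) (x : 'rV[R]_n) : 'rV[R]_m := lower_iter (y0 P) x J.

Definition fJ (J : nat) (x : 'rV[R]_n) : R := f x (yJ J x).

Definition slack (J : nat) (x : 'rV[R]_n) (y : 'rV[R]_m) : R :=
  fJ J x + eps P - f x y.

Definition G_fin (tau : R) (J : nat) (x : 'rV[R]_n) (y : 'rV[R]_m) : R :=
  F x y + tau * ln (slack J x y).

Definition G (tau : R) (J : nat) (x : 'rV[R]_n) (y : 'rV[R]_m) : \bar R :=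
  if 0 < slack J x y then (G_fin tau J x y)%:E else -oo%E.

(* Only used where slack > 0, where G coincides with G_fin nearby. The x
   derivative is relative to X because fJ is differentiable on X only: outside X
   the projections may be active. *)
Definition dxG (tau : R) (J : nat) (x : 'rV[R]_n) (y : 'rV[R]_m) : 'rV[R]_n :=
  grad X (fun x' => G_fin tau J x' y) x.

Definition dyG (tau : R) (J : nat) (x : 'rV[R]_n) (y : 'rV[R]_m) : 'rV[R]_m :=
  grad Y (G_fin tau J x) y.

Definition is_argmax_G (S : set 'rV[R]_m) (tau : R) (J : nat)
    (x : 'rV[R]_n) (y : 'rV[R]_m) : Prop :=
  S y /\ forall y', S y' -> (G tau J x y' <= G tau J x y)%E.

Definition Yuniform (J : nat) : set 'rV[R]_m :=
  [set y | Y y /\ forall z, X z -> c <= slack J z y].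

Definition Yslack (J : nat) (x : 'rV[R]_n) : set 'rV[R]_m :=
  [set y | Y y /\ c / 2 <= slack J x y].

Definition bounded_convex_sets : Prop :=
  [/\ X !=set0 /\ Y !=set0,
      convex_set X /\ convex_set Y,
      closed X /\ closed Y,
      0 < H /\ (forall x, X x -> enorm x <= H) &
      1 < M /\ (forall y, Y y -> enorm y <= M)].

Definition smooth_convex_data : Prop :=
  [/\ [/\ open C, convex_set C & X `<=` C],
      twice_cont_diff (prod_set C Y) (joint F) /\
      twice_cont_diff (prod_set C Y) (joint f),
      0 < mu P /\ (forall x, X x -> strongly_concave (mu P) Y (F x)) &
      convex_function (prod_set C Y) (joint f)].

Definition lipschitz_data : Prop :=
  let XY := prod_set X Y in
  [/\ lipschitz Num.norm XY (h0 P) (joint F) /\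
      lipschitz Num.norm XY (L0 P) (joint f),
      lipschitz enorm XY (h1 P) (grad (prod_set C Y) (joint F)) /\
      lipschitz enorm XY (L1 P) (grad (prod_set C Y) (joint f)),
      lipschitz spectral_norm XY (L2 P) (joint (dyx f)) &
      lipschitz spectral_norm XY (L3 P) (joint (dyy f))].

Definition interior_local_solutions : Prop :=
  forall x, local_solution x -> interior X x.

(* alpha = 1 / L1 only makes sense for L1 > 0. *)
Definition inactive_projections : Prop :=
  [/\ 0 < L1 P, alpha P = 1 / L1 P, Y (y0 P) &
      forall x y j, X x -> Y y ->
        lower_iter y x j.+1 =
        lower_iter y x j - alpha P *: dy f x (lower_iter y x j)].

Definition uniform_slack_maximizers : Prop :=
  [/\ 0 < c, c <= eps P / 2, c <= L0 P * H, c <= 1 &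
      forall tau J x, 0 < tau < 1 -> (0 < J)%N -> X x ->
        exists2 y, is_argmax_G Y tau J x y & Yuniform J y].

Definition interior_maximizers : Prop :=
  forall tau J x y, 0 < tau < 1 -> (0 < J)%N -> X x ->
    is_argmax_G (Yslack J x) tau J x y -> interior Y y.

Definition M1 (J : nat) : R := L0 P * (J%:R + 1).

Definition M2 (J : nat) : R :=
  L1 P * (1 + J%:R) ^+ 2 +
  L0 P * J%:R / L1 P * (1 + J%:R) * (L2 P + L3 P * J%:R).

Definition L11 (J : nat) : R :=
  h1 P + 1 / c * (M2 J + L1 P) + 1 / c ^+ 2 * (M1 J + L0 P) ^+ 2.

Definition L12 (J : nat) : R :=
  h1 P + 1 / c * L1 P + 1 / c ^+ 2 * L0 P * (M1 J + L0 P).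

Definition LG : R := h1 P + 2 / c * L1 P + 4 / c ^+ 2 * L0 P ^+ 2.

Definition Lphi (J : nat) : R := L11 J * (1 + 1 / mu P * L12 J).

Definition M3 : R :=
  let XY := prod_set X Y in
  Num.max
    `|inf [set joint F z | z in XY] + ln c|
    `|sup [set joint F z | z in XY] +
      ln (2 * sup [set `|joint f z| | z in XY] + eps P)|.

Definition l1 (J : nat) : R := Num.max 1 (Num.max (L11 J * H) LG).

Definition lbar (l2 : R) (J : nat) : R :=
  Num.max
    ((2 * H * (Lphi J / 2 + l2) + h0 P + 4 / c * L0 P) ^+ 2 / l2)
    (l1 J).

Definition is_FNE (sigma tau : R) (J : nat)
    (x : 'rV[R]_n) (y : 'rV[R]_m) : Prop :=
  [/\ X x /\ Y y, 0 < slack J x y,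
      forall x', X x' -> - sigma <= dot (dxG tau J x y) (x' - x) &
      enorm (dyG tau J x y) <= sigma].

Definition descent_dir (tau : R) (J : nat)
    (x : 'rV[R]_n) (z : 'rV[R]_m) : 'rV[R]_n :=
  dx F x z + (tau / slack J x z) *: (dx f x (yJ J x) - dx f x z).

(* xs t is the t-th outer iterate and zs t k the k-th inner iterate at step t;
   the initial points xs 0 and zs t 0 are arbitrary feasible choices. *)
Definition procedure_run (tau : R) (J T K : nat) (beta eta : R)
    (xs : nat -> 'rV[R]_n) (zs : nat -> nat -> 'rV[R]_m) : Prop :=
  X (xs 0%N) /\
  forall t, (t < T)%N ->
    [/\ Yslack J (xs t) (zs t 0%N),
        forall k, (k < K)%N ->
          zs t k.+1 = eproj (Yslack J (xs t))
                        (zs t k + beta *: dyG tau J (xs t) (zs t k)) &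
        xs t.+1 = eproj X (xs t - eta *: descent_dir tau J (xs t) (zs t K))].

Definition stationary_point (x : 'rV[R]_n) : Prop :=
  X x /\
  exists (y : 'rV[R]_m) (lam1 lam2 lam3 : R) (I J : nat)
         (r s : 'I_I -> 'I_J -> R)
         (ys : 'I_I -> 'rV[R]_m),
    let e i j :=
      dx F x (ys i) - s i j *: (dx f x (ys i) - grad C fstar x) in
    [/\ Reps x y,
        [/\ lam1 = 0 \/ lam1 = 1, 0 <= lam2, 0 <= lam3 &
            ~ [/\ lam1 = 0, lam2 = 0 & lam3 = 0]],
        [/\ forall i j, 0 <= r i j, \sum_i \sum_j r i j = 1,
            forall i, Reps x (ys i) & forall i j, 0 <= s i j],
        [/\ 0 = lam1 *: dx F x y
                + lam2 *: ((\sum_i \sum_j r i j *: e i j) - dx F x y)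
                + lam3 *: (dx f x y - grad C fstar x),
            exists2 v, normal_cone Y y v &
              0 = lam1 *: dy F x y - lam2 *: dy F x y + lam3 *: dy f x y + v &
            lam3 * (f x y - fstar x - eps P) = 0] &
        forall i j,
          s i j * (f x (ys i) - fstar x - eps P) = 0 /\
          exists2 v, normal_cone Y (ys i) v &
            0 = - dy F x (ys i) + s i j *: dy f x (ys i) + v].

End bilevel_problem.

(* Main.v *)
(* Along the FNE points the barrier weight tau / slack tends to zero, even after
   multiplication by J: the procedure projects onto Yslack, so slack >= c / 2,
   while tau = O(sigma^2 / J). Moreover yJ is J-Lipschitz in x, because a
   gradient step of a smooth convex function is nonexpansive, so the gradient of
   fJ is O(J). Hence both partial gradients of F vanish at the accumulation
   point (xbar, ybar). The O(1 / J) rate of gradient descent gives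
   f xbar ybar <= fstar xbar + eps, and strong concavity makes ybar a maximizer of
   F xbar. Stationarity then holds with lam1 = 1 and all other multipliers zero. *)

Require Import Defs.
From HB Require Import structures.
From mathcomp Require Import all_boot all_order all_algebra.
From mathcomp Require Import all_classical all_reals all_analysis.
From mathcomp Require Import ring lra.

Set Implicit Arguments.
Unset Strict Implicit.
Unset Printing Implicit Defensive.

Import Order.TTheory GRing.Theory Num.Theory.
Import numFieldNormedType.Exports.

Local Open Scope classical_set_scope.
Local Open Scope ring_scope.

(** * The Euclidean norm *)

(** The main obstacle is that [f x] is smooth and convex on [Y] only. The usual proof that a
    gradient step is nonexpansive evaluates the function at auxiliary points that may leave [Y]. It
    is therefore carried out first for close points well inside [Y], then for distant ones by
    cutting the segment, and finally up to the boundary by a retraction towards an interior point.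
    The crude Lipschitz constant 2 of a step would allow growth like [2 ^ J] in [yJ], which a
    barrier weight of order 1 / J cannot absorb. The gradient of [fJ] is never computed: the chain
    rule gives its existence, and a Lipschitz estimate gives its size. Since [grad] is a [get],
    every formula for it rests on uniqueness, which needs interior points: for [X] they lie near
    [xbar], for [Y] one is supplied by (A6) and (A7). No subsequence is extracted. For each small
    [d] a single index is within [d] of all its limits, and every quantity that must vanish or be
    nonpositive is bounded by a fixed constant times [d]. *)

Section euclidean_norm.
Context {R : realType}.

Lemma dotC {p} (u v : 'rV[R]_p) : dot u v = dot v u.
Proof. by apply: eq_bigr => i _; rewrite mulrC. Qed.

Lemma dotDl {p} (u v w : 'rV[R]_p) : dot (u + v) w = dot u w + dot v w.
Proof. by rewrite -big_split; apply: eq_bigr => i _; rewrite mxE mulrDl. Qed.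

Lemma dotZl {p} (a : R) (u w : 'rV[R]_p) : dot (a *: u) w = a * dot u w.
Proof. by rewrite mulr_sumr; apply: eq_bigr => i _; rewrite mxE mulrA. Qed.

Lemma dotDr {p} (u v w : 'rV[R]_p) : dot w (u + v) = dot w u + dot w v.
Proof. by rewrite dotC dotDl !(dotC w). Qed.

Lemma dotZr {p} (a : R) (u w : 'rV[R]_p) : dot w (a *: u) = a * dot w u.
Proof. by rewrite dotC dotZl dotC. Qed.

Lemma dotNl {p} (u w : 'rV[R]_p) : dot (- u) w = - dot u w.
Proof. by rewrite -scaleN1r dotZl mulN1r. Qed.

Lemma dotNr {p} (u w : 'rV[R]_p) : dot w (- u) = - dot w u.
Proof. by rewrite dotC dotNl dotC. Qed.

Lemma dotBl {p} (u v w : 'rV[R]_p) : dot (u - v) w = dot u w - dot v w.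
Proof. by rewrite dotDl dotNl. Qed.

Lemma dotBr {p} (u v w : 'rV[R]_p) : dot w (u - v) = dot w u - dot w v.
Proof. by rewrite dotDr dotNr. Qed.

Definition dotE := (@dotDl, @dotDr, @dotNl, @dotNr, @dotZl, @dotZr).

Lemma dot0l {p} (u : 'rV[R]_p) : dot 0 u = 0.
Proof. by rewrite -(scale0r 0) dotZl mul0r. Qed.

Lemma dot_ge0 {p} (u : 'rV[R]_p) : 0 <= dot u u.
Proof. by apply: sumr_ge0 => i _; exact: sqr_ge0. Qed.

Lemma enorm_ge0 {p} (u : 'rV[R]_p) : 0 <= enorm u.
Proof. exact: sqrtr_ge0. Qed.

Lemma enorm_sqr {p} (u : 'rV[R]_p) : enorm u ^+ 2 = dot u u.
Proof. by rewrite sqr_sqrtr// dot_ge0. Qed.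

Lemma coord_le_enorm {p} (u : 'rV[R]_p) i : `|u ord0 i| <= enorm u.
Proof.
rewrite -(@ler_pXn2r _ 2) ?nnegrE ?enorm_ge0// enorm_sqr real_normK ?num_real//.
rewrite /dot (bigD1 i)//= -expr2 lerDl.
by apply: sumr_ge0 => j _; exact: sqr_ge0.
Qed.

Lemma enorm0_eq0 {p} (u : 'rV[R]_p) : enorm u = 0 -> u = 0.
Proof.
move=> u0; apply/rowP => i; rewrite mxE; apply/eqP.
by rewrite -normr_eq0 eq_le normr_ge0 -u0 coord_le_enorm.
Qed.

Lemma enorm0 {p} : enorm (0 : 'rV[R]_p) = 0.
Proof. by rewrite /enorm dot0l sqrtr0. Qed.

Lemma enormZ {p} (a : R) (u : 'rV[R]_p) : enorm (a *: u) = `|a| * enorm u.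
Proof.
by rewrite /enorm dotZl dotZr mulrA -expr2 sqrtrM ?sqr_ge0// sqrtr_sqr.
Qed.

Lemma enormN {p} (u : 'rV[R]_p) : enorm (- u) = enorm u.
Proof. by rewrite -scaleN1r enormZ normrN1 mul1r. Qed.

Lemma enorm_distC {p} (u v : 'rV[R]_p) : enorm (u - v) = enorm (v - u).
Proof. by rewrite -enormN opprB. Qed.

Lemma Cauchy_Schwarz {p} (u v : 'rV[R]_p) : `|dot u v| <= enorm u * enorm v.
Proof.
rewrite -(@ler_pXn2r _ 2) ?nnegrE ?mulr_ge0 ?enorm_ge0//.
rewrite exprMn !enorm_sqr real_normK ?num_real//.
have := dot_ge0 v; rewrite le_eqVlt => /orP[/eqP v0|v0].
  have -> : v = 0 by apply: enorm0_eq0; rewrite /enorm -v0 sqrtr0.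
  by rewrite dotC !dot0l expr0n mulr0.
have := dot_ge0 (dot v v *: u - dot u v *: v).
rewrite !dotE (dotC v u) => h.
rewrite -subr_ge0 -(pmulr_rge0 _ v0).
by apply: le_trans h _; rewrite le_eqVlt; apply/orP; left; apply/eqP; ring.
Qed.

Lemma dot_le {p} (u v : 'rV[R]_p) : dot u v <= enorm u * enorm v.
Proof. exact: le_trans (ler_norm _) (Cauchy_Schwarz u v). Qed.

Lemma enormD {p} (u v : 'rV[R]_p) : enorm (u + v) <= enorm u + enorm v.
Proof.
rewrite -(@ler_pXn2r _ 2) ?nnegrE ?addr_ge0 ?enorm_ge0//.
rewrite sqrrD !enorm_sqr !dotE (dotC v u).
have := dot_le u v; lra.
Qed.

Lemma enormB {p} (u v : 'rV[R]_p) : enorm (u - v) <= enorm u + enorm v.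
Proof. by rewrite -(enormN v) enormD. Qed.

Lemma enorm_triangle {p} (w u v : 'rV[R]_p) :
  enorm (u - v) <= enorm (u - w) + enorm (w - v).
Proof. by rewrite -[u - v](subrKA w) enormD. Qed.

Lemma enorm_le_sum {p} (u : 'rV[R]_p) : enorm u <= \sum_i `|u ord0 i|.
Proof.
rewrite {1}[u]row_sum_delta; elim/big_ind2: _ => [|x a y b xa yb|i _].
- by rewrite enorm0.
- by apply: le_trans (enormD _ _) _; exact: lerD.
- rewrite enormZ ler_piMr// /enorm /dot (bigD1 i)//= big1 ?mxE ?eqxx.
    by rewrite mulr1 addr0 sqrtr1.
  by move=> j ji; rewrite mxE (negbTE ji) mulr0.
Qed.

Lemma enorm_row_mx {p q} (u : 'rV[R]_p) (v : 'rV[R]_q) :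
  enorm (row_mx u v) <= enorm u + enorm v.
Proof.
have -> : row_mx u v = row_mx u 0 + row_mx 0 v :> 'rV[R]_(p + q).
  by rewrite add_row_mx addr0 add0r.
apply: le_trans (enormD _ _) _; rewrite /enorm /dot !big_split_ord /=.
apply: lerD; apply: ler_wsqrtr; under eq_bigr do rewrite !row_mxEl;
  under [X in _ + X]eq_bigr do rewrite !row_mxEr.
  by rewrite [X in _ + X]big1 ?addr0// => i _; rewrite mxE mul0r.
by rewrite [X in X + _]big1 ?add0r// => i _; rewrite mxE mul0r.
Qed.

Lemma dot_row_mx {p q} (w : 'rV[R]_(p + q)) (u : 'rV[R]_p) (v : 'rV[R]_q) :
  dot w (row_mx u v) = dot (lsubmx w) u + dot (rsubmx w) v.
Proof.
rewrite /dot big_split_ord; congr (_ + _); apply: eq_bigr => i _.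
  by rewrite row_mxEl mxE.
by rewrite row_mxEr mxE.
Qed.

Lemma enorm_lsubmx {p q} (w : 'rV[R]_(p + q)) : enorm (lsubmx w) <= enorm w.
Proof.
apply: ler_wsqrtr; rewrite -{3 4}(hsubmxK w) dot_row_mx row_mxKl row_mxKr.
by rewrite lerDl dot_ge0.
Qed.

Lemma enorm_rsubmx {p q} (w : 'rV[R]_(p + q)) : enorm (rsubmx w) <= enorm w.
Proof.
apply: ler_wsqrtr; rewrite -{3 4}(hsubmxK w) dot_row_mx row_mxKl row_mxKr.
by rewrite lerDr dot_ge0.
Qed.

Lemma enorm_mulmx_bound {p q} (A : 'M[R]_(p, q)) :
  exists2 K, 0 <= K & forall v, enorm (v *m A) <= K * enorm v.
Proof.
exists (\sum_j enorm (col j A)^T); first by apply: sumr_ge0 => j _; exact: enorm_ge0.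
move=> v; apply: le_trans (enorm_le_sum _) _; rewrite mulr_suml.
apply: ler_sum => j _; rewrite mulrC; apply: le_trans (Cauchy_Schwarz _ _).
rewrite (_ : dot _ _ = (v *m A) ord0 j)// mxE.
by apply: eq_bigr => i _; rewrite !mxE.
Qed.

(** Translates the sup-norm neighbourhoods of the library into Euclidean balls. The radius is
    divided by [p.+1] instead of [p] so that the sum of the coordinates stays strictly below [d] and
    [p = 0] is covered. *)
Lemma near_enormP {p} (z : 'rV[R]_p) (Q : set 'rV[R]_p) :
  (\forall w \near z, Q w) <->
  exists2 d, 0 < d & forall w, enorm (w - z) < d -> Q w.
Proof.
split=> [/nbhs_ballP[d /= d0 dQ]|[d d0 dQ]].
  exists d => // w wz; apply: dQ; split=> // i j; rewrite /ball/= ord1.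
  rewrite distrC; have := coord_le_enorm (w - z) j; rewrite !mxE.
  by move/le_lt_trans; apply.
have d'0 : 0 < d / (p.+1)%:R by rewrite divr_gt0.
apply/nbhs_ballP; exists (d / (p.+1)%:R) => //= w [_ zw]; apply: dQ.
apply: le_lt_trans (enorm_le_sum _) _.
apply: (@le_lt_trans _ _ (\sum_(i < p) d / p.+1%:R)).
  by apply: ler_sum => i _; have /ltW := zw ord0 i; rewrite /ball/= distrC !mxE.
rewrite sumr_const card_ord -[X in X < _]mulr_natr -mulrA gtr_pMr//.
by rewrite mulrC ltr_pdivrMr// mul1r ltr_nat.
Qed.

Lemma interior_enormP {p} (S : set 'rV[R]_p) z :
  interior S z <-> exists2 d, 0 < d & forall w, enorm (w - z) < d -> S w.
Proof. exact: near_enormP. Qed.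

Lemma closed_enorm {p} (S : set 'rV[R]_p) z : closed S ->
  (forall d, 0 < d -> exists2 w, S w & enorm (w - z) < d) -> S z.
Proof.
move=> cS h; apply: cS => B /near_enormP[d d0 dB].
by have [w Sw wz] := h _ d0; exists w; split=> //; exact: dB.
Qed.

End euclidean_norm.

(** * Derivatives relative to a set *)

Section relative_derivatives.
Context {R : realType}.

Lemma is_jacP {p q} (S : set 'rV[R]_p) (g : 'rV[R]_p -> 'rV[R]_q) z A :
  is_jac S g z A <-> forall e, 0 < e -> exists2 d, 0 < d &
    forall w, S w -> enorm (w - z) < d ->
      enorm (g w - g z - (w - z) *m A) <= e * enorm (w - z).
Proof.
split=> h e e0.
  by have /near_enormP[d d0 hd] := h e e0; exists d => // w Sw wz; exact: hd.
by apply/near_enormP; have [d d0 hd] := h e e0; exists d => // w wz Sw; exact: hd.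
Qed.

Lemma enorm_scalar_mx (a : R) : enorm (a%:M : 'rV[R]_1) = `|a|.
Proof. by rewrite /enorm /dot big_ord1 mxE eqxx -expr2 sqrtr_sqr. Qed.

Lemma is_gradP {p} (S : set 'rV[R]_p) (g : 'rV[R]_p -> R) z v :
  is_grad S g z v <-> forall e, 0 < e -> exists2 d, 0 < d &
    forall w, S w -> enorm (w - z) < d ->
      `|g w - g z - dot v (w - z)| <= e * enorm (w - z).
Proof.
split=> h e e0.
  by have /near_enormP[d d0 hd] := h e e0; exists d => // w Sw wz; exact: hd.
by apply/near_enormP; have [d d0 hd] := h e e0; exists d => // w wz Sw; exact: hd.
Qed.

(** Lets the chain rule and linearity be proved once, for [is_jac], and then transferred to
    gradients. *)
Lemma is_grad_jac {p} (S : set 'rV[R]_p) (g : 'rV[R]_p -> R) z v :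
  is_grad S g z v <-> is_jac S (fun w => (g w)%:M : 'rV[R]_1) z v^T.
Proof.
have E w : enorm ((g w)%:M - (g z)%:M - (w - z) *m v^T : 'rV[R]_1) =
           `|g w - g z - dot v (w - z)|.
  have -> : (w - z) *m v^T = (dot v (w - z))%:M :> 'rV[R]_1.
    rewrite [LHS]mx11_scalar; congr (_%:M); rewrite mxE.
    by apply: eq_bigr => i _; rewrite !mxE mulrC.
  by rewrite -!raddfB enorm_scalar_mx.
by split=> h e e0; apply: filterS (h e e0) => w hw Sw; move: (hw Sw); rewrite E.
Qed.

Lemma is_jac_eq {p q} (S : set 'rV[R]_p) (g h : 'rV[R]_p -> 'rV[R]_q) z A :
  (forall w, S w -> g w = h w) -> S z -> is_jac S g z A -> is_jac S h z A.
Proof.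
move=> gh Sz dg e e0; apply: filterS (dg e e0) => w hw Sw.
by rewrite -!gh//; exact: hw.
Qed.

Lemma is_grad_eq {p} (S : set 'rV[R]_p) (g h : 'rV[R]_p -> R) z v :
  (forall w, S w -> g w = h w) -> S z -> is_grad S g z v -> is_grad S h z v.
Proof.
move=> gh Sz dg e e0; apply: filterS (dg e e0) => w hw Sw.
by rewrite -!gh//; exact: hw.
Qed.

Lemma is_grad_subset {p} (S S' : set 'rV[R]_p) (g : 'rV[R]_p -> R) z v :
  S' `<=` S -> is_grad S g z v -> is_grad S' g z v.
Proof.
by move=> SS dg e e0; apply: filterS (dg e e0) => w hw /SS Sw; exact: hw.
Qed.

Lemma is_jac_id {p} (S : set 'rV[R]_p) z : is_jac S id z 1%:M.
Proof.
move=> e e0; near=> w => _.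
by rewrite mulmx1 subrr enorm0 mulr_ge0 ?enorm_ge0// ltW.
Unshelve. all: by end_near. Qed.

Lemma is_jac_cst {p q} (S : set 'rV[R]_p) (c : 'rV[R]_q) z :
  is_jac S (fun=> c) z 0.
Proof.
move=> e e0; near=> w => _.
by rewrite mulmx0 !subrr enorm0 mulr_ge0 ?enorm_ge0// ltW.
Unshelve. all: by end_near. Qed.

Lemma is_grad_cst {p} (S : set 'rV[R]_p) (c : R) z : is_grad S (fun=> c) z 0.
Proof.
move=> e e0; near=> w => _.
by rewrite dot0l !subrr normr0 mulr_ge0 ?enorm_ge0// ltW.
Unshelve. all: by end_near. Qed.

Lemma is_jac_lin {p q} (S : set 'rV[R]_p) (g h : 'rV[R]_p -> 'rV[R]_q) a z A B :
  is_jac S g z A -> is_jac S h z B ->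
  is_jac S (fun w => g w + a *: h w) z (A + a *: B).
Proof.
move=> dg dh e e0; have e'0 : 0 < e / 2 by lra.
have e''0 : 0 < e / 2 / (`|a| + 1) by rewrite divr_gt0// ltr_wpDl.
apply: filterS2 (dg _ e'0) (dh _ e''0) => w gw hw Sw.
have -> : g w + a *: h w - (g z + a *: h z) - (w - z) *m (A + a *: B) =
    (g w - g z - (w - z) *m A) + a *: (h w - h z - (w - z) *m B).
  rewrite mulmxDr -scalemxAr !scalerBr.
  by apply/rowP => i; rewrite !mxE; ring.
apply: le_trans (enormD _ _) _; rewrite enormZ.
rewrite [e in leRHS]splitr mulrDl lerD ?gw//.
apply: (@le_trans _ _ ((`|a| + 1) * (e / 2 / (`|a| + 1) * enorm (w - z)))).
  by apply: ler_pM => //; rewrite ?enorm_ge0 ?lerDl ?hw.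
by rewrite mulrA [(_ + 1) * _]mulrC divfK// gt_eqF// ltr_wpDl.
Qed.

Lemma is_jac_row_mx {p q r} (S : set 'rV[R]_p) (g : 'rV[R]_p -> 'rV[R]_q)
    (h : 'rV[R]_p -> 'rV[R]_r) z A B :
  is_jac S g z A -> is_jac S h z B ->
  is_jac S (fun w => row_mx (g w) (h w)) z (row_mx A B).
Proof.
move=> dg dh e e0; have e'0 : 0 < e / 2 by lra.
apply: filterS2 (dg _ e'0) (dh _ e'0) => w gw hw Sw.
rewrite mul_mx_row !opp_row_mx !add_row_mx.
apply: le_trans (enorm_row_mx _ _) _.
by rewrite [e in leRHS]splitr mulrDl lerD ?gw ?hw.
Qed.

Lemma is_jac_rsubmx {p q r} (S : set 'rV[R]_p) (g : 'rV[R]_p -> 'rV[R]_(q + r))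
    z A :
  is_jac S g z A -> is_jac S (fun w => rsubmx (g w)) z (rsubmx A).
Proof.
move=> dg e e0; apply: filterS (dg _ e0) => w gw Sw.
by apply: le_trans (gw Sw); rewrite mulmx_rsub -!raddfB; exact: enorm_rsubmx.
Qed.

Lemma is_jac_locally_lipschitz {p q} (S : set 'rV[R]_p)
    (g : 'rV[R]_p -> 'rV[R]_q) z A :
  is_jac S g z A -> exists2 K, 0 < K & exists2 d, 0 < d &
    forall w, S w -> enorm (w - z) < d ->
      enorm (g w - g z) <= K * enorm (w - z).
Proof.
have [K K0 KA] := enorm_mulmx_bound A.
move=> /is_jacP/(_ _ ltr01)[d d0 dg]; exists (K + 1); first lra.
exists d => // w Sw wz; have := dg w Sw wz.
have := enormD (g w - g z - (w - z) *m A) ((w - z) *m A).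
have := KA (w - z); rewrite subrK; lra.
Qed.

Lemma is_jac_comp {p q r} (S : set 'rV[R]_p) (S' : set 'rV[R]_q)
    (h : 'rV[R]_p -> 'rV[R]_q) (g : 'rV[R]_q -> 'rV[R]_r) z A B :
  (forall w, S w -> S' (h w)) ->
  is_jac S h z A -> is_jac S' g (h z) B ->
  is_jac S (fun w => g (h w)) z (A *m B).
Proof.
move=> SS' dh dg; apply/is_jacP => e e0.
have [K K0 [d1 d10 hK]] := is_jac_locally_lipschitz dh.
have [N N0 NB] := enorm_mulmx_bound B.
(* Each half of [e] pays for one error: that of [g], magnified by the local Lipschitz constant [K]
   of [h], and that of [h], magnified by the operator bound [N] of [B]. [N] may be zero, hence
   [N + 1]. *)
have e1 : 0 < e / 2 / K by rewrite !divr_gt0.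
have e2 : 0 < e / 2 / (N + 1) by rewrite !divr_gt0//; lra.
have [d2 d20 hg] := (is_jacP _ _ _ _).1 dg _ e1.
have [d3 d30 hh] := (is_jacP _ _ _ _).1 dh _ e2.
have d2K : 0 < d2 / K by rewrite divr_gt0.
exists (Num.min d1 (Num.min (d2 / K) d3)); first by rewrite !lt_min d10 d2K d30.
move=> w Sw; rewrite !lt_min => /and3P[w1 w2 w3].
have -> : g (h w) - g (h z) - (w - z) *m (A *m B) =
    (g (h w) - g (h z) - (h w - h z) *m B) + (h w - h z - (w - z) *m A) *m B.
  by rewrite !mulmxBl !mulmxA; apply/rowP => i; rewrite !mxE; ring.
apply: le_trans (enormD _ _) _; rewrite [e in leRHS]splitr mulrDl.
have hw := hK w Sw w1; apply: lerD.
  have hd2 : enorm (h w - h z) < d2.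
    by apply: le_lt_trans hw _; rewrite mulrC -ltr_pdivlMr.
  apply: le_trans (hg _ (SS' _ Sw) hd2) _.
  apply: (@le_trans _ _ (e / 2 / K * (K * enorm (w - z)))).
    by rewrite ler_pM2l.
  by rewrite mulrA divfK ?gt_eqF.
apply: le_trans (NB _) _.
apply: (@le_trans _ _ ((N + 1) * (e / 2 / (N + 1) * enorm (w - z)))).
  by apply: ler_pM => //; rewrite ?enorm_ge0 ?lerDl ?hh.
by rewrite mulrA [(_ + 1) * _]mulrC divfK// gt_eqF//; lra.
Qed.

Lemma is_grad_comp {p q} (S : set 'rV[R]_p) (S' : set 'rV[R]_q)
    (h : 'rV[R]_p -> 'rV[R]_q) (g : 'rV[R]_q -> R) z A v :
  (forall w, S w -> S' (h w)) ->
  is_jac S h z A -> is_grad S' g (h z) v ->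
  is_grad S (fun w => g (h w)) z (v *m A^T).
Proof.
move=> SS' dh /is_grad_jac dg; apply/is_grad_jac.
by rewrite trmx_mul trmxK; exact: is_jac_comp SS' dh dg.
Qed.

Lemma is_grad_lin {p} (S : set 'rV[R]_p) (g h : 'rV[R]_p -> R) a z v w :
  is_grad S g z v -> is_grad S h z w ->
  is_grad S (fun x => g x + a * h x) z (v + a *: w).
Proof.
move=> /is_grad_jac dg /is_grad_jac dh; apply/is_grad_jac.
rewrite raddfD/= linearZ/=.
have -> : (fun x => (g x + a * h x)%:M : 'rV[R]_1) =
    (fun x => (g x)%:M + a *: (h x)%:M).
  by apply/funext => x; rewrite raddfD/= scale_scalar_mx.
exact: is_jac_lin.
Qed.

Lemma is_grad_shift {p} (S : set 'rV[R]_p) (g : 'rV[R]_p -> R) c z v :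
  is_grad S g z v -> is_grad S (fun x => g x + c) z v.
Proof.
move=> dg e e0; apply: filterS (dg e e0) => w hw Sw.
have -> : g w + c - (g z + c) = g w - g z by ring.
exact: hw.
Qed.

(** With [u] the relative increment, both sides come from ln (1 + x) <= x: at [u] for the upper
    bound and at [- (u / (1 + u))], which inverts 1 + u, for the lower one. The condition u >= -1/2
    is exactly what makes u / (1 + u) at least u - 2 u^2. *)
Lemma ln_taylor (s s' : R) : 0 < s -> `|s' - s| <= s / 2 ->
  `|ln s' - ln s - (s' - s) / s| <= 2 * ((s' - s) / s) ^+ 2.
Proof.
move=> s0 ss'; set u := (s' - s) / s.
have {ss'} u12 : `|u| <= 2^-1.
  by rewrite normrM normfV (gtr0_norm s0) ler_pdivrMr// mulrC.
have [u1 u2] : - 2^-1 <= u /\ u <= 2^-1 by apply/andP; rewrite -ler_norml.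
have s'E : s' = s * (1 + u) by rewrite /u; field; lra.
have u0 : 0 < 1 + u by lra.
have -> : ln s' - ln s = ln (1 + u).
  by rewrite s'E lnM ?posrE// addrAC subrr add0r.
have up : ln (1 + u) <= u by apply: le_ln1Dx; lra.
have lo : u / (1 + u) <= ln (1 + u).
  have := @le_ln1Dx _ (- (u / (1 + u))).
  have -> : 1 + - (u / (1 + u)) = (1 + u)^-1 by field; lra.
  rewrite lnV ?posrE// => h.
  suff : - ln (1 + u) <= - (u / (1 + u)) by rewrite lerN2.
  by apply: h; rewrite ltrN2 ltr_pdivrMr//; lra.
have : u - 2 * u ^+ 2 <= u / (1 + u).
  by rewrite ler_pdivlMr//; nra.
by rewrite ler_norml => h; apply/andP; split; have := sqr_ge0 u; lra.
Qed.

Lemma is_grad_locally_lipschitz {p} (S : set 'rV[R]_p) (g : 'rV[R]_p -> R) z v :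
  is_grad S g z v -> exists2 K, 0 < K & exists2 d, 0 < d &
    forall w, S w -> enorm (w - z) < d -> `|g w - g z| <= K * enorm (w - z).
Proof.
move=> /is_grad_jac/is_jac_locally_lipschitz[K K0 [d d0 hK]].
exists K => //; exists d => // w Sw wz; have := hK w Sw wz.
by rewrite -raddfB enorm_scalar_mx.
Qed.

Lemma is_grad_ln {p} (S : set 'rV[R]_p) (g : 'rV[R]_p -> R) z v :
  0 < g z -> is_grad S g z v ->
  is_grad S (fun x => ln (g x)) z ((g z)^-1 *: v).
Proof.
move=> s0 dg; set s := g z in s0 *; apply/is_gradP => e e0.
have [K K0 [d1 d10 hK]] := is_grad_locally_lipschitz dg.
have e1 : 0 < e / 2 * s by rewrite !mulr_gt0.
have [d2 d20 hg] := (is_gradP _ _ _ _).1 dg _ e1.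
have d30 : 0 < s / 2 / K by rewrite !divr_gt0.
have d40 : 0 < e / 4 * s ^+ 2 / K ^+ 2 by rewrite divr_gt0 ?mulr_gt0 ?exprn_gt0.
(* The third radius puts the increment in the range of [ln_taylor]; the fourth makes the quadratic
   remainder at most half of the allowed error. *)
exists (Num.min (Num.min d1 d2) (Num.min (s / 2 / K) (e / 4 * s ^+ 2 / K ^+ 2))).
  by rewrite !lt_min d10 d20 d30.
move=> w Sw; rewrite !lt_min => /andP[/andP[w1 w2] /andP[w3 w4]].
have hw := hK w Sw w1; rewrite -/s in hw.
have {}w3 : `|g w - s| <= s / 2.
  by apply: le_trans hw _; rewrite mulrC -ler_pdivlMr ?ltW.
have T := ln_taylor s0 w3; have L := hg w Sw w2; rewrite -/s in L.
have q : 2 * ((g w - s) / s) ^+ 2 <= e / 2 * enorm (w - z).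
  rewrite expr_div_n mulrA ler_pdivrMr ?exprn_gt0//.
  apply: (@le_trans _ _ (2 * (K * enorm (w - z)) ^+ 2)).
    rewrite ler_pM2l// -[leLHS]real_normK ?num_real//.
    by apply: lerXn2r; rewrite ?nnegrE// mulr_ge0 ?enorm_ge0 ?ltW.
  move: w4; rewrite ltr_pdivlMr ?exprn_gt0// => w4.
  have := enorm_ge0 (w - z); nra.
have -> : ln (g w) - ln s - dot (s^-1 *: v) (w - z) =
   (ln (g w) - ln s - (g w - s) / s) + (g w - s - dot v (w - z)) / s.
  by rewrite dotZl; field; rewrite gt_eqF.
apply: le_trans (ler_normD _ _) _; rewrite [e in leRHS]splitr [leRHS]mulrDl lerD//.
  exact: le_trans q.
rewrite normrM normfV (gtr0_norm s0) ler_pdivrMr//.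
by apply: le_trans L _; rewrite mulrAC.
Qed.

End relative_derivatives.

(** * Convex sets and functions *)

Section convexity.
Context {R : realType}.

Definition segment_convex {p} (S : set 'rV[R]_p) (g : 'rV[R]_p -> R) :=
  forall a b t, S a -> S b -> 0 <= t <= 1 ->
    g (b + t *: (a - b)) <= g b + t * (g a - g b).

Lemma segmentE {p} (a b : 'rV[R]_p) (t : R) :
  b + t *: (a - b) = t *: a + (1 - t) *: b.
Proof. by apply/rowP => i; rewrite !mxE; ring. Qed.

Lemma convex_set_segment {p} (S : set 'rV[R]_p) a b t :
  convex_set S -> S a -> S b -> 0 <= t <= 1 -> S (b + t *: (a - b)).
Proof.
move=> cS Sa Sb /andP[t0 t1]; rewrite segmentE; apply: set_mem.
by apply: (cS a b (Itv01 t0 t1)); exact: mem_set.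
Qed.

Lemma convex_function_segment {p} (S : set 'rV[R]_p) (g : 'rV[R]_p -> R) :
  convex_function S g -> segment_convex S g.
Proof.
move=> cg a b t Sa Sb /andP[t0 t1].
have := cg (Itv01 t0 t1) a b (mem_set Sa) (mem_set Sb).
rewrite segmentE => h; apply: le_trans h _; rewrite le_eqVlt; apply/orP; left.
by apply/eqP; rewrite convRE/= /unstable.onem; ring.
Qed.

(* The increment is measured against [t] rather than [t * enorm (w - z)], which
   makes the estimate usable when [w = z]. *)
Lemma is_grad_segment {p} (S : set 'rV[R]_p) (g : 'rV[R]_p -> R) z v w e :
  convex_set S -> S z -> S w -> is_grad S g z v -> 0 < e ->
  exists2 t0, 0 < t0 <= 1 & forall t, 0 < t <= t0 ->
    `|g (z + t *: (w - z)) - g z - t * dot v (w - z)| <= e * t.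
Proof.
move=> cS Sz Sw /is_gradP dg e0; set N := enorm (w - z).
have N1 : 0 < N + 1 by rewrite ltr_wpDl ?enorm_ge0.
have [d d0 hd] := dg _ (divr_gt0 e0 N1).
exists (Num.min 1 (d / (N + 1))).
  by rewrite lt_min ltr01 divr_gt0//= ge_min lexx.
move=> t /andP[t0]; rewrite le_min ler_pdivlMr// => /andP[t1 td].
have E : z + t *: (w - z) - z = t *: (w - z) by rewrite addrAC subrr add0r.
have tN : enorm (t *: (w - z)) = t * N by rewrite enormZ gtr0_norm.
have := hd (z + t *: (w - z)); rewrite E tN dotZr => h.
apply: le_trans (h _ _) _.
- by apply: convex_set_segment => //; rewrite t1 ltW.
- by apply: lt_le_trans td; rewrite ltr_pM2l// ltrDl.
- rewrite mulrAC ler_pdivrMr// -mulrA ler_pM2l// ler_pM2l//.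
  by rewrite lerDl.
Qed.

(** Here [z] may be a boundary point. Difference quotients along segments show that [v - v'] is
    orthogonal to [w - z] for every [w] in [S]; comparing [w = z0] with [z0] shifted along [v - v']
    makes its norm vanish. *)
Lemma is_grad_unique {p} (S : set 'rV[R]_p) (g : 'rV[R]_p -> R) z z0 v v' :
  convex_set S -> interior S z0 -> S z ->
  is_grad S g z v -> is_grad S g z v' -> v = v'.
Proof.
move=> cS /interior_enormP[r r0 Sr] Sz dv dv'.
have Sz0 : S z0 by apply: Sr; rewrite subrr enorm0.
have key w : S w -> dot (v - v') (w - z) = 0.
  move=> Sw; apply/eqP; rewrite -normr_eq0 eq_le normr_ge0 andbT.
  apply/ler_addgt0Pr => e e0; rewrite add0r.
  have e20 : 0 < e / 2 by lra.
  have [t1 /andP[t10 t11] h1] := is_grad_segment cS Sz Sw dv e20.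
  have [t2 /andP[t20 t21] h2] := is_grad_segment cS Sz Sw dv' e20.
  pose t := Num.min t1 t2.
  have t0 : 0 < t by rewrite lt_min t10.
  have := h1 t; have := h2 t; rewrite t0 /= !ge_min !lexx orbT => /(_ isT) k2 /(_ isT) k1.
  rewrite -(ler_pM2l t0) -{1}(gtr0_norm t0) -normrM dotBl.
  move: k1 k2; rewrite !ler_norml => /andP[a1 a2] /andP[b1 b2].
  by apply/andP; split; lra.
apply/eqP; rewrite -subr_eq0; apply/eqP/enorm0_eq0; set u := v - v' in key *.
set N := enorm u; have N0 : 0 <= N by exact: enorm_ge0.
have N1 : 0 < N + 1 by lra.
have Su : S (z0 + (r / (N + 1)) *: u).
  apply: Sr; rewrite addrAC subrr add0r enormZ gtr0_norm ?divr_gt0// -/N.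
  by rewrite mulrAC ltr_pdivrMr// ltr_pM2l//; lra.
have := key _ Sz0; have := key _ Su.
rewrite !dotBr dotDr dotZr -enorm_sqr -/N => h1 h2.
have : r / (N + 1) * N ^+ 2 = 0 by lra.
by move/eqP; rewrite mulf_eq0 gt_eqF ?divr_gt0//= expf_eq0/= => /eqP.
Qed.

Lemma gradE {p} (S : set 'rV[R]_p) (g : 'rV[R]_p -> R) z z0 v :
  convex_set S -> interior S z0 -> S z -> is_grad S g z v -> grad S g z = v.
Proof.
move=> cS iS Sz dv; apply: (is_grad_unique cS iS Sz _ dv); exact: (getI dv).
Qed.

Lemma is_grad_convex {p} (S : set 'rV[R]_p) (g : 'rV[R]_p -> R) a b v :
  convex_set S -> segment_convex S g -> S a -> S b -> is_grad S g b v ->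
  g b + dot v (a - b) <= g a.
Proof.
move=> cS cg Sa Sb dg; apply/ler_addgt0Pr => e e0.
have [t /andP[t0 t1] /(_ t)] := is_grad_segment cS Sb Sa dg e0.
rewrite t0 lexx ler_norml => /(_ isT) /andP[h _].
have := cg a b t Sa Sb; rewrite (ltW t0) t1 => /(_ isT) h'.
rewrite -(ler_pM2l t0); lra.
Qed.

(** The increment is tested in the direction of [v] itself. This bounds the gradient of the slack in
    [x] without a formula for it. *)
Lemma is_grad_enorm_le {p} (S : set 'rV[R]_p) (g : 'rV[R]_p -> R) z v L :
  interior S z -> is_grad S g z v -> 0 <= L ->
  (forall w, S w -> `|g w - g z| <= L * enorm (w - z)) -> enorm v <= L.
Proof.
move=> /interior_enormP[r r0 Sr] /is_gradP dg L0 gL.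
apply/ler_addgt0Pr => e e0.
have [d d0 hd] := dg _ e0; set N := enorm v.
have N0 : 0 <= N by exact: enorm_ge0.
have N1 : 0 < N + 1 by lra.
pose t := Num.min r d / (N + 1).
have t0 : 0 < t by rewrite divr_gt0// lt_min r0.
have E : z + t *: v - z = t *: v by rewrite addrAC subrr add0r.
have tN : enorm (t *: v) = t * N by rewrite enormZ gtr0_norm.
have tlt : t * N < Num.min r d.
  by rewrite mulrAC ltr_pdivrMr// ltr_pM2l ?lt_min ?r0//; lra.
move: tlt; rewrite lt_min => /andP[tr td].
have Sw : S (z + t *: v) by apply: Sr; rewrite E tN.
have := hd _ Sw; have := gL _ Sw; rewrite E tN dotZr -enorm_sqr -/N.
rewrite !ler_norml => /andP[_ h1] /(_ td) /andP[h2 _].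
have h : t * N * N <= t * N * (L + e) by lra.
have [->|] := eqVneq N 0; first lra.
move=> N'0; have : 0 < t * N by rewrite mulr_gt0// lt_neqAle eq_sym N'0.
by move/ler_pM2l => <-.
Qed.

Lemma continuous_enorm_dist {p} (z : 'rV[R]_p) :
  continuous (fun w : 'rV[R]_p => enorm (z - w)).
Proof.
move=> w B /nbhs_ballP[e /= e0 eB]; apply/near_enormP; exists e => // u uw.
apply: eB; rewrite /ball/=.
have := enorm_triangle u z w; have := enorm_triangle w z u.
rewrite (enorm_distC w u) => h1 h2.
by rewrite ltr_norml; apply/andP; split; lra.
Qed.

(** Since [eproj] is a [get], nothing is known about it until a nearest point exists; compactness
    provides one. *)
Lemma eproj_is_eproj {p} (S : set 'rV[R]_p) M z :
  S !=set0 -> closed S -> (forall w, S w -> enorm w <= M) ->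
  is_eproj S z (eproj S z).
Proof.
move=> S0 cS SM; have cptS : compact S.
  apply: bounded_closed_compact => //; exists M; split; first exact: num_real.
  move=> x Mx w Sw; apply: le_trans (ltW Mx); apply: le_trans (SM w Sw).
  rewrite [leLHS]/Num.norm/= mx_normrE; apply: bigmax_le; first exact: enorm_ge0.
  by case=> i j _ /=; rewrite ord1 coord_le_enorm.
have [w Sw hw] := EVT_min_rV S0 cptS
  (continuous_subspaceT (@continuous_enorm_dist _ z)).
apply: (@getI _ _ w); split; first exact: set_mem.
by move=> w' Sw'; apply: hw; exact: mem_set.
Qed.

End convexity.

(** * Gradient steps of smooth convex functions *)

Section gradient_step.
Context {R : realType} {p : nat}.
Variables (S : set 'rV[R]_p) (g : 'rV[R]_p -> R) (D : 'rV[R]_p -> 'rV[R]_p).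
Variables (L : R).
Hypotheses (cS : convex_set S) (cg : segment_convex S g).
Hypothesis dg : forall z, S z -> is_grad S g z (D z).
Hypothesis L0 : 0 < L.
Hypothesis DL : forall a b, S a -> S b -> enorm (D a - D b) <= L * enorm (a - b).

(* Halving the segment turns a quadratic bound with constant [C] into one with
   constant [C / 2 + L / 4], whose fixed point is [L / 2]. *)
Lemma descent a b : S a -> S b ->
  g b <= g a + dot (D a) (b - a) + L / 2 * enorm (b - a) ^+ 2.
Proof.
have step k : forall a b, S a -> S b -> g b <= g a + dot (D a) (b - a) +
    (L / 2 + L / 2 / 2 ^+ k) * enorm (b - a) ^+ 2.
  elim: k => [|k IH] {}a {}b Sa Sb.
    rewrite expr0 divr1 -splitr.
    have h1 := is_grad_convex cS cg Sa Sb (dg Sb).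
    have h2 := dot_le (D b - D a) (b - a).
    have h3 := ler_wpM2r (enorm_ge0 (b - a)) (DL Sb Sa).
    move: h1 h2; rewrite -opprB dotNr dotBl expr2; lra.
  pose m := a + 2^-1 *: (b - a).
  have Sm : S m by apply: convex_set_segment => //; apply/andP; split; lra.
  have bm : b - m = 2^-1 *: (b - a) by apply/rowP => i; rewrite !mxE; field.
  have ma : m - a = 2^-1 *: (b - a) by apply/rowP => i; rewrite !mxE; field.
  have h1 := IH a m Sa Sm; have h2 := IH m b Sm Sb.
  have h3 := dot_le (D m - D a) (b - a).
  have h4 := ler_wpM2r (enorm_ge0 (b - a)) (DL Sm Sa).
  have n2 : `|2^-1| = 2^-1 :> R by rewrite ger0_norm.
  move: h1 h2 h4; rewrite bm ma !dotZr !enormZ !exprMn n2 [2 ^+ k.+1]exprS invfM.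
  move: h3; rewrite dotBl; set E := enorm (b - a).
  by set q := (2 ^+ k)^-1; rewrite expr2; lra.
move=> Sa Sb; apply/ler_addgt0Pr => e e0.
set E := enorm (b - a) ^+ 2; have E0 : 0 <= E by exact: sqr_ge0.
have [k hk] : exists k, L / 2 * E / e < k%:R.
  by exists (Num.truncn (L / 2 * E / e)).+1; exact: truncnS_gt.
have h := step k a b Sa Sb.
suff : L / 2 / 2 ^+ k * E <= e by move: h; rewrite -/E; lra.
rewrite mulrAC ler_pdivrMr ?exprn_gt0// [e * _]mulrC -ler_pdivrMr//.
rewrite ltW// (lt_le_trans hk)// -natrX ler_nat ltnW//; exact: ltn_expl.
Qed.

Hypothesis step_in : forall a, S a -> S (a - L^-1 *: D a).

Let T a := a - L^-1 *: D a.

(** Convexity at [a] towards [c], descent from [b] to [c] and convexity at [b] towards [a] add up to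
    |d|^2 / (2 L) <= <d, b - a>. This is half of the Baillon-Haddad inequality and exactly what a
    step 1 / L requires; it needs only one auxiliary point in [S]. *)
Lemma gradient_step_nonexpansive_near a b : S a -> S b ->
  S (b - L^-1 *: (D b - D a)) -> enorm (T b - T a) <= enorm (b - a).
Proof.
move=> Sa Sb; set d := D b - D a => Sc; set c := b - _ in Sc.
have h1 := is_grad_convex cS cg Sc Sa (dg Sa).
have h2 := descent Sb Sc.
have h3 := is_grad_convex cS cg Sa Sb (dg Sb).
have cb : c - b = - (L^-1 *: d) by rewrite /c addrAC subrr add0r.
have ca : c - a = (b - a) - L^-1 *: d by rewrite /c addrAC.
have TE : T b - T a = (b - a) - L^-1 *: d.
  by apply/rowP => i; rewrite !mxE; ring.
have dd : dot d d = dot (D b) d - dot (D a) d by rewrite {1}/d dotBl.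
have du : dot d (b - a) = dot (D b) (b - a) - dot (D a) (b - a).
  by rewrite dotBl.
clearbody c d.
have hd : L^-1 * dot d d / 2 <= dot d (b - a).
  move: h1 h2 h3 du; rewrite cb ca -(opprB b a); move: (b - a) => u.
  rewrite !enormN enormZ exprMn enorm_sqr dotBr !dotNr !dotZr normfV.
  rewrite (gtr0_norm L0) => h1 h2 h3 du.
  have : L / 2 * (L^-1 ^+ 2 * dot d d) = L^-1 * dot d d / 2.
    by field; rewrite gt_eqF.
  move: h1 h2; rewrite dd du; lra.
rewrite -(@ler_pXn2r _ 2) ?nnegrE ?enorm_ge0//.
rewrite TE !enorm_sqr; move: (b - a) hd => u hd.
rewrite !dotE (dotC u d) -subr_ge0.
have Li : 0 < L^-1 by rewrite invr_gt0.
have := ler_wpM2l (ltW Li) hd; lra.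
Qed.

(** The auxiliary point lies within |b - a| of [b], hence in [S] when |b - a| < r. Longer segments
    are bisected: by convexity the midpoint keeps a ball of radius [r], and the bounds on the two
    halves add up without loss. *)
Lemma gradient_step_nonexpansive_interior r a b : 0 < r ->
  (forall w, enorm (w - a) < r -> S w) -> (forall w, enorm (w - b) < r -> S w) ->
  enorm (T b - T a) <= enorm (b - a).
Proof.
move=> r0.
have step k : forall a b, enorm (b - a) < 2 ^+ k * r ->
    (forall w, enorm (w - a) < r -> S w) -> (forall w, enorm (w - b) < r -> S w) ->
    enorm (T b - T a) <= enorm (b - a).
  elim: k => [|k IH] {}a {}b.
    rewrite expr0 mul1r => ba Sra Srb.
    have Sa : S a by apply: Sra; rewrite subrr enorm0.
    have Sb : S b by apply: Srb; rewrite subrr enorm0.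
    apply: gradient_step_nonexpansive_near => //; apply: Srb.
    rewrite addrAC subrr add0r enormN enormZ normfV (gtr0_norm L0) mulrC.
    by rewrite ltr_pdivrMr// (le_lt_trans (DL Sb Sa))// mulrC ltr_pM2r.
  rewrite exprS => ba Sra Srb; pose m := a + 2^-1 *: (b - a).
  have n2 : `|2^-1| = 2^-1 :> R by rewrite ger0_norm.
  have bm : b - m = 2^-1 *: (b - a) by apply/rowP => i; rewrite !mxE; field.
  have ma : m - a = 2^-1 *: (b - a) by apply/rowP => i; rewrite !mxE; field.
  have Srm w : enorm (w - m) < r -> S w.
    move=> wm; have -> : w = a + (w - m) + 2^-1 *: (b + (w - m) - (a + (w - m))).
      by apply/rowP => i; rewrite !mxE; field.
    apply: convex_set_segment => //.
    - by apply: Srb; rewrite addrAC subrr add0r.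
    - by apply: Sra; rewrite addrAC subrr add0r.
    - by apply/andP; split; lra.
  have := IH a m; have := IH m b; rewrite bm ma !enormZ n2.
  move=> /(_ _ Srm Srb) h1 /(_ _ Sra Srm) h2.
  apply: le_trans (enorm_triangle (T m) _ _) _.
  have hm : 2^-1 * enorm (b - a) < 2 ^+ k * r.
    by rewrite mulrC ltr_pdivrMr// mulrC mulrA.
  by apply: le_trans (lerD (h1 hm) (h2 hm)) _; rewrite -mulrDl -div1r -splitr mul1r.
set E := enorm (b - a).
apply: (step (Num.truncn (E / r)).+1).
rewrite -ltr_pdivrMr//; apply: lt_trans (truncnS_gt _) _.
by rewrite -natrX ltr_nat; exact: ltn_expl.
Qed.

(** Moving [a] and [b] a fraction [t] towards [z0] gives both a ball of radius [t * r] in [S] and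
    contracts their distance. As [T] is 2-Lipschitz on [S], the move costs at most [C * t], and [t]
    is arbitrary. *)
Lemma gradient_step_nonexpansive z0 a b : interior S z0 -> S a -> S b ->
  enorm (T b - T a) <= enorm (b - a).
Proof.
move=> /interior_enormP[r r0 Sr] Sa Sb.
set C := 2 * (enorm (z0 - a) + enorm (z0 - b)).
have C0 : 0 <= C by rewrite mulr_ge0// addr_ge0 ?enorm_ge0.
have Tlip c d : S c -> S d -> enorm (T c - T d) <= 2 * enorm (c - d).
  move=> Sc Sd; have -> : T c - T d = (c - d) - L^-1 *: (D c - D d).
    by apply/rowP => i; rewrite !mxE; ring.
  apply: le_trans (enormB _ _) _; rewrite enormZ normfV (gtr0_norm L0).
  have : L^-1 * enorm (D c - D d) <= enorm (c - d).
    by rewrite mulrC ler_pdivrMr// mulrC DL.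
  lra.
have Sz0 : S z0 by apply: Sr; rewrite subrr enorm0.
suff h t : 0 < t <= 1 -> enorm (T b - T a) <= enorm (b - a) + C * t.
  apply/ler_addgt0Pr => e e0; pose t := Num.min 1 (e / (C + 1)).
  have C1 : 0 < C + 1 by lra.
  have t0 : 0 < t by rewrite lt_min ltr01 divr_gt0.
  apply: le_trans (h t _) _; first by rewrite t0 ge_min lexx.
  rewrite lerD2l; apply: (@le_trans _ _ ((C + 1) * t)).
    by rewrite ler_pM2r//; lra.
  by rewrite mulrC -ler_pdivlMr// ge_min lexx orbT.
move=> /andP[t0 t1].
pose mv c := c + t *: (z0 - c).
have ball c : S c -> forall w, enorm (w - mv c) < t * r -> S w.
  move=> Sc w wc; have -> : w = c + t *: (z0 + t^-1 *: (w - mv c) - c).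
    by apply/rowP => i; rewrite !mxE; field; rewrite gt_eqF.
  apply: convex_set_segment => //; last by rewrite (ltW t0).
  apply: Sr; rewrite addrAC subrr add0r enormZ normfV (gtr0_norm t0).
  by rewrite mulrC ltr_pdivrMr// mulrC.
have Smv c : S c -> S (mv c).
  by move=> Sc; apply: convex_set_segment => //; rewrite t1 ltW.
have mvE c : enorm (c - mv c) = t * enorm (z0 - c).
  have -> : c - mv c = - (t *: (z0 - c)) by rewrite /mv opprD addNKr.
  by rewrite enormN enormZ gtr0_norm.
have tr : 0 < t * r by rewrite mulr_gt0.
have h1 := gradient_step_nonexpansive_interior tr (ball a Sa) (ball b Sb).
have h2 := Tlip _ _ Sb (Smv _ Sb).
have h3 := Tlip _ _ (Smv _ Sa) Sa.
have h4 : enorm (mv b - mv a) <= enorm (b - a).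
  have -> : mv b - mv a = (1 - t) *: (b - a).
    by apply/rowP => i; rewrite !mxE; ring.
  by rewrite enormZ ger0_norm ?subr_ge0// ler_piMl ?enorm_ge0// gerBl ltW.
apply: le_trans (enorm_triangle (T (mv b)) _ _) _.
apply: le_trans (lerD h2 (enorm_triangle (T (mv a)) _ _)) _.
apply: le_trans (lerD (lexx _) (lerD h1 h3)) _.
rewrite (enorm_distC (mv a)) !mvE [X in X <= _](_ : _ =
  enorm (mv b - mv a) + C * t); first by rewrite lerD2r.
by rewrite /C; ring.
Qed.

(** Descent to [T a] plus convexity at [a] bounds the gap by <D a, a - y> - |D a|^2 / (2 L);
    completing the square turns it into a difference that telescopes. The case [y = a] gives
    monotonicity. *)
Lemma gradient_step_decrease a y : S a -> S y ->
  g (T a) - g y <= L / 2 * (enorm (a - y) ^+ 2 - enorm (T a - y) ^+ 2).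
Proof.
move=> Sa Sy; have h1 := descent Sa (step_in Sa).
have h2 := is_grad_convex cS cg Sy Sa (dg Sa).
have E : T a - a = - (L^-1 *: D a) by rewrite /T addrAC subrr add0r.
have E' : T a - y = (a - y) - L^-1 *: D a by rewrite /T addrAC.
move: h1; rewrite -/(T a) E E' -enormN opprK !enorm_sqr.
move: h2; rewrite -(opprB a y) dotNr; move: (a - y) => u h2.
have -> : dot (u - L^-1 *: D a) (u - L^-1 *: D a) =
    dot u u - 2 * L^-1 * dot (D a) u + L^-1 * (L^-1 * dot (D a) (D a)).
  by rewrite !dotE (dotC u); ring.
rewrite !(dotNr, dotNl, dotZr, dotZl).
move: h2; set A := dot (D a) u; set B := dot (D a) (D a); set Q := dot u u => h2.
have -> : L / 2 * (Q - (Q - 2 * L^-1 * A + L^-1 * (L^-1 * B))) =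
    A - L^-1 * B / 2 by field; rewrite gt_eqF.
have -> : L / 2 * (L^-1 * (L^-1 * B)) = L^-1 * B / 2 by field; rewrite gt_eqF.
lra.
Qed.

(** The decreases telescope, and by monotonicity the last gap, counted [N] times, is at most the sum
    of the gaps. *)
Lemma gradient_descent_rate (ys : nat -> 'rV[R]_p) y N :
  S (ys 0%N) -> (forall j, ys j.+1 = T (ys j)) -> S y ->
  N%:R * (g (ys N) - g y) <=
    L / 2 * (enorm (ys 0%N - y) ^+ 2 - enorm (ys N - y) ^+ 2).
Proof.
move=> S0 ysS Sy.
have Sys j : S (ys j) by elim: j => // j IH; rewrite ysS; exact: step_in.
elim: N => [|N IH]; first by rewrite mul0r subrr mulr0.
have h1 := gradient_step_decrease (Sys N) Sy.
have h2 := gradient_step_decrease (Sys N) (Sys N).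
rewrite -ysS in h1 h2.
have h3 : g (ys N.+1) <= g (ys N).
  rewrite -subr_le0; apply: le_trans h2 _; rewrite pmulr_rle0 ?divr_gt0//.
  by rewrite subrr enorm0 expr0n/= sub0r oppr_le0 sqr_ge0.
have h4 : N%:R * (g (ys N.+1) - g y) <= N%:R * (g (ys N) - g y).
  by rewrite ler_wpM2l// lerD2r.
rewrite -natr1 mulrDl mul1r; lra.
Qed.

End gradient_step.

(** * The bilevel problem *)

Section bilevel_gradients.
Context {R : realType} {n m : nat}.
Variable P : bilevel R n m.

Local Notation X := (feasX P).
Local Notation C := (domC P).
Local Notation Y := (feasY P).
Local Notation F := (upper P).
Local Notation f := (lower P).
Local Notation CY := (prod_set C Y).

Hypothesis hsets : bounded_convex_sets P.
Hypothesis hsmooth : smooth_convex_data P.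
Hypothesis hlip : lipschitz_data P.
Hypothesis hproj : inactive_projections P.
Hypothesis hslack : uniform_slack_maximizers P.
Hypothesis hmax : interior_maximizers P.

Let convX : convex_set X. Proof. by case: hsets => _ []. Qed.
Let convY : convex_set Y. Proof. by case: hsets => _ []. Qed.
Let convC : convex_set C. Proof. by case: hsmooth => -[]. Qed.
Let XC : X `<=` C. Proof. by case: hsmooth => -[]. Qed.
Let L1_gt0 : 0 < L1 P. Proof. by case: hproj. Qed.

Lemma prod_setP (A : set 'rV[R]_n) x y : A x -> Y y -> prod_set A Y (row_mx x y).
Proof. by move=> Ax Yy; split; rewrite ?row_mxKl ?row_mxKr. Qed.

(** The global maximizer of (A6) has slack at least [c], so it also maximizes over the smaller set
    [Yslack], and (A7) makes it interior. The values 1/2 and 1 for [tau] and [J] are arbitrary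
    admissible choices. *)
Lemma feasY_interior : exists y, interior Y y.
Proof.
case: hsets => -[[x Xx] _] _ _ _ _.
have t01 : 0 < (2^-1 : R) < 1 by apply/andP; split; lra.
case: hslack => c0 _ _ _ /(_ 2^-1 1%N x t01 isT Xx)[y [Yy ymax] [_ ycs]].
exists y; apply: (hmax t01 (isT : (0 < 1)%N) Xx); split=> [|y' []]; last first.
  by move=> Yy' _; exact: ymax.
split=> //; apply: le_trans (ycs x Xx); rewrite ler_pdivrMr//; lra.
Qed.

Lemma interior_domC x : C x -> interior C x.
Proof. by move=> Cx; case: hsmooth => -[oC _ _] _ _ _; exact: open_nbhs_nbhs. Qed.

Section partial_gradients.
Variable g : 'rV[R]_n -> 'rV[R]_m -> R.
Hypothesis sg : twice_cont_diff CY (joint g).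

Lemma is_grad_joint x y : C x -> Y y ->
  is_grad CY (joint g) (row_mx x y) (grad CY (joint g) (row_mx x y)).
Proof.
move=> Cx Yy; case: sg => dg [d2g [h _ _]].
exact: getI (h _ (prod_setP Cx Yy)).
Qed.

Lemma is_grad_partial_y x y v : C x -> Y y ->
  is_grad CY (joint g) (row_mx x y) v -> is_grad Y (g x) y (rsubmx v).
Proof.
move=> Cx Yy dv.
have := is_grad_comp (fun w Yw => prod_setP Cx Yw)
  (is_jac_row_mx (is_jac_cst Y x y) (is_jac_id Y y)) dv.
rewrite tr_row_mx -{1}(hsubmxK v) mul_row_col trmx0 mulmx0 add0r trmx1 mulmx1.
by apply: is_grad_eq => // w _; rewrite /joint row_mxKl row_mxKr.
Qed.

Lemma is_grad_partial_x x y v : C x -> Y y ->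
  is_grad CY (joint g) (row_mx x y) v -> is_grad C (g^~ y) x (lsubmx v).
Proof.
move=> Cx Yy dv.
have := is_grad_comp (fun w Cw => prod_setP Cw Yy)
  (is_jac_row_mx (is_jac_id C x) (is_jac_cst C y x)) dv.
rewrite tr_row_mx -{1}(hsubmxK v) mul_row_col trmx0 mulmx0 addr0 trmx1 mulmx1.
by apply: is_grad_eq => // w _; rewrite /joint row_mxKl row_mxKr.
Qed.

(** Identifies the partial gradient with a block of the joint one, through which the Lipschitz
    assumptions of (A3) reach it. *)
Lemma dyE x y : C x -> Y y -> dy P g x y = rsubmx (grad CY (joint g) (row_mx x y)).
Proof.
move=> Cx Yy; have [y1 iy1] := feasY_interior.
exact: gradE convY iy1 Yy (is_grad_partial_y Cx Yy (is_grad_joint Cx Yy)).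
Qed.

Lemma dxE x y : C x -> Y y -> dx P g x y = lsubmx (grad CY (joint g) (row_mx x y)).
Proof.
move=> Cx Yy; exact: gradE convC (interior_domC Cx) Cx
  (is_grad_partial_x Cx Yy (is_grad_joint Cx Yy)).
Qed.

Lemma is_grad_dy x y : C x -> Y y -> is_grad Y (g x) y (dy P g x y).
Proof.
by move=> Cx Yy; rewrite dyE//; exact: is_grad_partial_y (is_grad_joint _ _).
Qed.

Lemma is_grad_dx x y : C x -> Y y -> is_grad C (g^~ y) x (dx P g x y).
Proof.
by move=> Cx Yy; rewrite dxE//; exact: is_grad_partial_x (is_grad_joint _ _).
Qed.

Lemma is_jac_dy x y : C x -> Y y ->
  exists B, is_jac CY (joint (dy P g)) (row_mx x y) B.
Proof.
move=> Cx Yy; case: sg => dg [d2g [h1 h2 _]]; have CYz := prod_setP Cx Yy.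
exists (rsubmx (d2g (row_mx x y))).
apply: is_jac_eq CYz (is_jac_rsubmx (h2 _ CYz)) => w [Cw Yw].
have [y1 iy1] := feasY_interior; apply/esym/(gradE convY iy1 Yw).
by apply: is_grad_partial_y => //; rewrite hsubmxK; exact: h1.
Qed.

Variable L : R.
Hypothesis lg : Defs.lipschitz enorm (prod_set X Y) L (grad CY (joint g)).

Lemma grad_joint_lipschitz x y x' y' : X x -> Y y -> X x' -> Y y' ->
  enorm (grad CY (joint g) (row_mx x y) - grad CY (joint g) (row_mx x' y')) <=
  L * (enorm (x - x') + enorm (y - y')).
Proof.
move=> Xx Yy Xx' Yy'; case: lg => L_ge0 h.
apply: le_trans (h _ _ (prod_setP Xx Yy) (prod_setP Xx' Yy')) _.
by rewrite ler_wpM2l// opp_row_mx add_row_mx enorm_row_mx.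
Qed.

Lemma dy_lipschitz x y x' y' : X x -> Y y -> X x' -> Y y' ->
  enorm (dy P g x y - dy P g x' y') <= L * (enorm (x - x') + enorm (y - y')).
Proof.
move=> Xx Yy Xx' Yy'; rewrite !dyE//; try exact: XC.
by rewrite -raddfB; apply: le_trans (enorm_rsubmx _) _; exact: grad_joint_lipschitz.
Qed.

Lemma dx_lipschitz x y x' y' : X x -> Y y -> X x' -> Y y' ->
  enorm (dx P g x y - dx P g x' y') <= L * (enorm (x - x') + enorm (y - y')).
Proof.
move=> Xx Yy Xx' Yy'; rewrite !dxE//; try exact: XC.
by rewrite -raddfB; apply: le_trans (enorm_lsubmx _) _; exact: grad_joint_lipschitz.
Qed.

End partial_gradients.

(** * The lower-level iterates and their dependence on [x] *)

Let sF : twice_cont_diff CY (joint F). Proof. by case: hsmooth => _ []. Qed.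
Let sf : twice_cont_diff CY (joint f). Proof. by case: hsmooth => _ []. Qed.
Let lf : Defs.lipschitz enorm (prod_set X Y) (L1 P) (grad CY (joint f)).
Proof. by case: hlip => _ []. Qed.

Lemma lower_lipschitz x y x' y' : X x -> Y y -> X x' -> Y y' ->
  `|f x y - f x' y'| <= L0 P * (enorm (x - x') + enorm (y - y')).
Proof.
move=> Xx Yy Xx' Yy'; case: hlip => -[_ [L0_ge0 h]] _ _ _.
have := h _ _ (prod_setP Xx Yy) (prod_setP Xx' Yy').
rewrite /joint !row_mxKl !row_mxKr => /le_trans; apply.
by rewrite ler_wpM2l// opp_row_mx add_row_mx enorm_row_mx.
Qed.

Lemma lower_segment_convex x : C x -> segment_convex Y (f x).
Proof.
move=> Cx a b t Ya Yb t01; case: hsmooth => _ _ _ /convex_function_segment cf.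
have := cf _ _ t (prod_setP Cx Ya) (prod_setP Cx Yb) t01.
rewrite opp_row_mx add_row_mx scale_row_mx add_row_mx subrr scaler0 addr0.
by rewrite /joint !row_mxKl !row_mxKr.
Qed.

Lemma dy_lower_lipschitz x a b : X x -> Y a -> Y b ->
  enorm (dy P f x a - dy P f x b) <= L1 P * enorm (a - b).
Proof.
move=> Xx Ya Yb; apply: le_trans (dy_lipschitz sf lf Xx Ya Xx Yb) _.
by rewrite subrr enorm0 add0r.
Qed.

(** (A5) with a single step from an arbitrary [y]: the plain gradient step equals a projection onto
    [Y]. *)
Lemma lower_step_in x y : X x -> Y y -> Y (y - (L1 P)^-1 *: dy P f x y).
Proof.
move=> Xx Yy; case: hproj => _ aE _ /(_ x y 0%N Xx Yy) /=.
rewrite aE div1r => <-; case: hsets => -[_ Y0] _ [_ cY] _ [_ YM].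
by have [] := eproj_is_eproj (y - (L1 P)^-1 *: dy P f x y) Y0 cY YM.
Qed.

Lemma yJ_S j x : X x -> yJ P j.+1 x = yJ P j x - (L1 P)^-1 *: dy P f x (yJ P j x).
Proof.
move=> Xx; case: hproj => _ aE Yy0 /(_ x _ j Xx Yy0).
by rewrite aE div1r.
Qed.

Lemma yJ_feasY j x : X x -> Y (yJ P j x).
Proof.
move=> Xx; elim: j => [|j IH]; first by case: hproj.
by rewrite yJ_S//; exact: lower_step_in.
Qed.

(** The start is common. Each step carries the previous distance over without growth, at fixed [x],
    and adds one [enorm (x - x')] for the change of [x] at a fixed point, since the step length
    cancels [L1]. Growth is thus linear in [j]. *)
Lemma yJ_lipschitz j x x' : X x -> X x' ->
  enorm (yJ P j x - yJ P j x') <= j%:R * enorm (x - x').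
Proof.
move=> Xx Xx'; elim: j => [|j IH]; first by rewrite subrr enorm0 mul0r.
have [Yx Yx'] := (yJ_feasY j Xx, yJ_feasY j Xx').
rewrite !yJ_S//; set y := yJ P j x in IH Yx *; set y' := yJ P j x' in IH Yx' *.
apply: le_trans (enorm_triangle (y' - (L1 P)^-1 *: dy P f x y') _ _) _.
rewrite -natr1 mulrDl mul1r; apply: lerD.
  apply: le_trans IH; have [y1 iy1] := feasY_interior.
  apply: (gradient_step_nonexpansive convY (lower_segment_convex (XC Xx))
    (fun z Yz => is_grad_dy sf (XC Xx) Yz) L1_gt0) iy1 Yx' Yx.
  by move=> a b; exact: dy_lower_lipschitz.
rewrite opprD opprK addrACA subrr add0r addrC -scalerBr enormZ.
rewrite normfV (gtr0_norm L1_gt0) mulrC ler_pdivrMr// mulrC.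
apply: le_trans (dy_lipschitz sf lf Xx' Yx' Xx Yx') _.
by rewrite subrr enorm0 addr0 enorm_distC.
Qed.

Lemma fJ_lipschitz j x x' : X x -> X x' ->
  `|fJ P j x - fJ P j x'| <= M1 P j * enorm (x - x').
Proof.
move=> Xx Xx'; have [Yx Yx'] := (yJ_feasY j Xx, yJ_feasY j Xx').
apply: le_trans (lower_lipschitz Xx Yx Xx' Yx') _.
rewrite /M1 -mulrA ler_wpM2l//; first by case: hlip => -[_ []].
by rewrite mulrDl mul1r addrC lerD2r yJ_lipschitz.
Qed.

(** The constant is [L1 / 2] times the square of [2 * boundY P], a bound on the diameter of [Y]. Any
    [y] may serve for comparison, so no lower-level minimizer is chosen. *)
Lemma fJ_rate j x y : X x -> Y y -> (0 < j)%N ->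
  fJ P j x <= f x y + 2 * L1 P * boundY P ^+ 2 * j%:R^-1.
Proof.
move=> Xx Yy j0; case: hsets => _ _ _ _ [M1_gt YM].
have j0R : 0 < j%:R :> R by rewrite ltr0n.
have h := gradient_descent_rate convY (lower_segment_convex (XC Xx))
  (fun z Yz => is_grad_dy sf (XC Xx) Yz) L1_gt0
  (fun a b Ya Yb => dy_lower_lipschitz Xx Ya Yb)
  (fun a Ya => lower_step_in Xx Ya) j (yJ_feasY 0 Xx)
  (fun j => yJ_S j Xx) Yy.
have hb : enorm (yJ P 0 x - y) ^+ 2 <= (2 * boundY P) ^+ 2.
  have b0 : 0 <= 2 * boundY P by lra.
  rewrite lerXn2r ?nnegrE ?enorm_ge0//.
  have := YM _ (yJ_feasY 0 Xx); have := YM _ Yy.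
  by have := enormB (yJ P 0 x) y; lra.
rewrite -lerBlDl ler_pdivlMr// mulrC; apply: le_trans h _.
apply: (@le_trans _ _ (L1 P / 2 * (2 * boundY P) ^+ 2)).
  rewrite ler_wpM2l ?divr_ge0 ?(ltW L1_gt0)//.
  by apply: le_trans hb; rewrite gerBl sqr_ge0.
by rewrite le_eqVlt; apply/orP; left; apply/eqP; field.
Qed.

(** The derivative is relative to [X] because the unprojected recursion is available there only. *)
Lemma is_jac_yJ j x : X x -> exists A, is_jac X (yJ P j) x A.
Proof.
move=> Xx; elim: j => [|j [A dA]]; first by exists 0; exact: is_jac_cst.
have [B dB] := is_jac_dy sf (XC Xx) (yJ_feasY j Xx).
exists (A - (L1 P)^-1 *: (row_mx 1%:M A *m B)).
have dyj : is_jac X (fun w => joint (dy P f) (row_mx w (yJ P j w))) x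
    (row_mx 1%:M A *m B).
  apply: is_jac_comp (is_jac_row_mx (is_jac_id X x) dA) dB.
  by move=> w Xw; apply: prod_setP (yJ_feasY j Xw); exact: XC.
rewrite -scaleNr; apply: is_jac_eq (is_jac_lin _ dA dyj) => // w Xw.
by rewrite yJ_S// scaleNr /joint row_mxKl row_mxKr.
Qed.

Lemma is_grad_fJ j x : X x -> exists v, is_grad X (fJ P j) x v.
Proof.
move=> Xx; have [A dA] := is_jac_yJ j Xx.
have dfj := is_grad_joint sf (XC Xx) (yJ_feasY j Xx).
exists (grad CY (joint f) (row_mx x (yJ P j x)) *m (row_mx 1%:M A)^T).
have := is_grad_comp (fun w Xw => prod_setP (XC Xw) (yJ_feasY j Xw))
  (is_jac_row_mx (is_jac_id X x) dA) dfj.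
by apply: is_grad_eq => // w _; rewrite /joint row_mxKl row_mxKr.
Qed.

(** * Gradients of the barrier function and a lower bound on the slack *)

Lemma dyGE tau j x y : X x -> Y y -> 0 < slack P j x y ->
  dyG P tau j x y = dy P F x y - (tau / slack P j x y) *: dy P f x y.
Proof.
move=> Xx Yy s0; have [y1 iy1] := feasY_interior.
apply: (gradE convY iy1 Yy).
have dF := is_grad_dy sF (XC Xx) Yy; have df := is_grad_dy sf (XC Xx) Yy.
have ds : is_grad Y (slack P j x) y (- dy P f x y).
  rewrite -scaleN1r -[_ *: _]add0r.
  have := is_grad_lin (-1) (is_grad_cst Y (fJ P j x + eps P) y) df.
  by apply: is_grad_eq => // w _; rewrite /slack mulN1r.
have := is_grad_lin tau dF (is_grad_ln s0 ds).
by rewrite scalerN scalerN scalerA.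
Qed.

Lemma slack_lipschitz_x j x x' y : X x -> X x' -> Y y ->
  `|slack P j x y - slack P j x' y| <= L0 P * (j%:R + 2) * enorm (x - x').
Proof.
move=> Xx Xx' Yy.
have -> : slack P j x y - slack P j x' y =
  (fJ P j x - fJ P j x') - (f x y - f x' y) by rewrite /slack; ring.
apply: le_trans (ler_normB _ _) _.
apply: le_trans (lerD (fJ_lipschitz j Xx Xx') (lower_lipschitz Xx Yy Xx' Yy)) _.
by rewrite subrr enorm0 addr0 -mulrDl /M1 -{2}[L0 P]mulr1 -mulrDr -addrA.
Qed.

(** The vector [u] is the gradient of the slack in [x]. Its bound is the Lipschitz constant of the
    slack: [j + 1] parts from [fJ] and one from [f]. *)
Lemma dxGE tau j x y : interior X x -> Y y -> 0 < slack P j x y ->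
  exists2 u, enorm u <= L0 P * (j%:R + 2) &
    dxG P tau j x y = dx P F x y + (tau / slack P j x y) *: u.
Proof.
move=> iX Yy s0; have Xx : X x by exact: interior_subset.
have [v dv] := is_grad_fJ j Xx.
have dF := is_grad_subset XC (is_grad_dx sF (XC Xx) Yy).
have df := is_grad_subset XC (is_grad_dx sf (XC Xx) Yy).
have ds : is_grad X (fun w => slack P j w y) x (v + -1 *: dx P f x y).
  have := is_grad_lin (-1) (is_grad_shift (eps P) dv) df.
  by apply: is_grad_eq => // w _; rewrite /slack mulN1r.
exists (v + -1 *: dx P f x y).
  apply: is_grad_enorm_le iX ds _ _ => [|w Xw]; last exact: slack_lipschitz_x.
  by rewrite mulr_ge0 ?addr_ge0//; case: hlip => -[_ []].
apply: (gradE convX iX Xx).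
have := is_grad_lin tau dF (@is_grad_ln _ _ X (fun w => slack P j w y) x _ s0 ds).
by rewrite scalerA.
Qed.

Lemma closed_Yslack j x : X x -> closed (Yslack P j x).
Proof.
move=> Xx w cw; case: hsets => _ _ [_ cY] _ _.
have Yw : Y w by apply: cY => B /cw[z [[Yz _] Bz]]; exists z.
split=> //; have L0_ge0 : 0 <= L0 P by case: hlip => -[_ []].
apply/ler_addgt0Pr => e e0.
have d0 : 0 < e / (L0 P + 1) by rewrite divr_gt0// ltr_wpDl.
have : nbhs w [set z | enorm (z - w) < e / (L0 P + 1)].
  by apply/near_enormP; exists (e / (L0 P + 1)).
move=> /cw[z [[Yz cz] /= zw]]; apply: le_trans cz _.
have := lower_lipschitz Xx Yz Xx Yw; rewrite subrr enorm0 add0r ler_norml.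
move=> /andP[h _]; rewrite -lerBlDl.
have -> : slack P j x z - slack P j x w = - (f x z - f x w).
  by rewrite /slack; ring.
rewrite lerNl; apply: le_trans h; rewrite lerN2.
apply: (@le_trans _ _ ((L0 P + 1) * enorm (z - w))).
  by rewrite ler_wpM2r ?enorm_ge0// lerDl.
by rewrite mulrC -ler_pdivlMr ?ltr_wpDl// ltW.
Qed.

(** The equilibrium condition alone gives a positive slack with no uniform bound. With at least one
    inner step, the last inner iterate is a projection onto [Yslack]. *)
Lemma procedure_slack tau j N k beta eta xs zs t :
  procedure_run P tau j N k.+1 beta eta xs zs -> (t < N)%N -> X (xs t) ->
  cslack P / 2 <= slack P j (xs t) (zs t k.+1).
Proof.
move=> [_ run] tN Xx; case: (run t tN) => z0 /(_ k (leqnn _)) -> _.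
have S0 : Yslack P j (xs t) !=set0 by exists (zs t 0%N).
have SM y : Yslack P j (xs t) y -> enorm y <= boundY P.
  by case: hsets => _ _ _ _ [_ YM] [Yy _]; exact: YM.
by have [[]] := eproj_is_eproj (zs t k + beta *: dyG P tau j (xs t) (zs t k))
  S0 (closed_Yslack Xx) SM.
Qed.

Lemma upper_maximizer x y y' : X x -> Y y -> Y y' -> dy P F x y = 0 ->
  F x y' <= F x y.
Proof.
move=> Xx Yy Yy' dF0; case: hsmooth => _ _ [mu0 /(_ x Xx) cF] _.
(* The form [0 + -1 * F x y] of the negated function is the one that [is_grad_lin] produces. *)
have cNF : segment_convex Y (fun y => 0 + -1 * F x y).
  move=> a b t Ya Yb t01; have := cF a b t Ya Yb t01; rewrite -segmentE.
  have : 0 <= mu P / 2 * t * (1 - t) * enorm (a - b) ^+ 2.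
    case/andP: t01 => t0 t1.
    apply: mulr_ge0; last exact: sqr_ge0.
    by rewrite !mulr_ge0 ?subr_ge0 ?(ltW mu0).
  lra.
have dNF := is_grad_lin (-1) (is_grad_cst Y 0 y) (is_grad_dy sF (XC Xx) Yy).
have := is_grad_convex convY cNF Yy' Yy dNF.
by rewrite dF0 scaler0 addr0 dot0l; lra.
Qed.

End bilevel_gradients.

(** * Quantitative passage to the limit *)

Lemma le0_of_le_small {R : realType} (a C d0 : R) : 0 < d0 ->
  (forall d, 0 < d -> d <= d0 -> a <= C * d) -> a <= 0.
Proof.
move=> d00 h; rewrite leNgt; apply/negP => a0.
have C1 : 0 < `|C| + 1 by rewrite ltr_wpDl.
pose d := Num.min d0 (a / 2 / (`|C| + 1)).
have d_gt0 : 0 < d by rewrite lt_min d00 !divr_gt0.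
have h1 : a <= C * d by apply: h => //; rewrite ge_min lexx.
have h2 : C * d <= (`|C| + 1) * d.
  by rewrite ler_pM2r// (le_trans (ler_norm C))// lerDl.
have : (`|C| + 1) * d <= a / 2.
  by rewrite mulrC -ler_pdivlMr// ge_min lexx orbT.
lra.
Qed.

(** In the interior the one-sided inequality can be tested at [x] moved by r / 2 against [v], which
    turns it into a norm bound. *)
Lemma first_order_small {R : realType} {p} (S : set 'rV[R]_p) x v r s : 0 < r ->
  (forall w, enorm (w - x) < r -> S w) ->
  (forall w, S w -> - s <= dot v (w - x)) -> enorm v <= 2 / r * s.
Proof.
move=> r0 Sr h; set N := enorm v; have N0 : 0 <= N by exact: enorm_ge0.
suff : r / 2 * N <= s by rewrite -ler_pdivlMl ?divr_gt0// invf_div.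
have [NE|N'0] := eqVneq N 0.
  have := h x; rewrite NE mulr0 subrr dotC dot0l => h0.
  by have := h0 (Sr x _); rewrite subrr enorm0 => /(_ r0); lra.
have {N'0} N_gt0 : 0 < N by rewrite lt_neqAle eq_sym N'0.
have E : x - (r / 2 / N) *: v - x = - ((r / 2 / N) *: v).
  by rewrite addrAC subrr add0r.
have Sw : S (x - (r / 2 / N) *: v).
  apply: Sr; rewrite E enormN enormZ gtr0_norm ?divr_gt0//.
  by rewrite divfK ?gt_eqF//; lra.
have := h _ Sw; rewrite E dotNr dotZr -enorm_sqr -/N lerN2.
by rewrite expr2 mulrA divfK// gt_eqF.
Qed.

(** Uses s^2 <= s, lb >= 1, j + 2 <= 3 j and w >= c / 2: the factor 2 / c times 3 j, against 36 j,
    leaves 1 / 6. *)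
Lemma barrier_weight_le {R : realType} (c H L s lb tau w : R) (j : nat) :
  0 < c -> 0 < H -> 0 < L -> 0 < s < 1 -> 1 <= lb -> (0 < j)%N -> 0 < tau ->
  tau <= c * s ^+ 2 / (36 * H * j%:R * L * lb) -> c / 2 <= w ->
  tau / w * (L * (j%:R + 2)) <= s / (6 * H).
Proof.
move=> c0 H0 L0 /andP[s0 s1] lb1 j0 tau0 htau cw.
have j1 : 1 <= j%:R :> R by rewrite ler1n.
have jgt0 : 0 < j%:R :> R by lra.
have w0 : 0 < w by lra.
have h1 : tau * (36 * H * j%:R * L) <= c * s.
  have : 0 < 36 * H * j%:R * L by rewrite !mulr_gt0.
  move: (36 * H * j%:R * L) htau => D + D0.
  rewrite ler_pdivlMr ?mulr_gt0//; last by lra.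
  rewrite (mulrA tau) => h; apply: (@le_trans _ _ (tau * D * lb)).
    by rewrite ler_peMr// mulr_ge0// ltW.
  by apply: le_trans h _; rewrite ler_pM2l// expr2 ger_pMr// ltW.
have h2 : tau * (L * (j%:R + 2)) * H <= c * s / 12.
  apply: (@le_trans _ _ (tau * (36 * H * j%:R * L) / 12)); last lra.
  have -> : tau * (36 * H * j%:R * L) / 12 = tau * L * H * (3 * j%:R) by field.
  have -> : tau * (L * (j%:R + 2)) * H = tau * L * H * (j%:R + 2) by ring.
  by rewrite ler_pM2l ?mulr_gt0//; lra.
rewrite mulrAC ler_pdivrMr// mulrAC ler_pdivlMr ?mulr_gt0//.
have : s * (c / 2) <= s * w by rewrite ler_pM2l.
lra.
Qed.

Theorem theorem4 (R : realType) (n m : nat) (P : bilevel R n m)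
  (eps_gt0 : 0 < eps P)
  (hsets : bounded_convex_sets P)
  (hsmooth : smooth_convex_data P)
  (hlip : lipschitz_data P)
  (hloc : interior_local_solutions P)
  (hproj : inactive_projections P)
  (hslack : uniform_slack_maximizers P)
  (hmax : interior_maximizers P)
  (l2 : R) (hl2 : 0 < l2 < 1)
  (sigma : nat -> R)
  (hsigma : forall l, 0 < sigma l < 1)
  (sigma0 : sigma l @[l --> \oo] --> (0 : R))
  (J : nat -> nat)
  (hJ : forall l, (0 < J l)%N)
  (Joo : J l @[l --> \oo] --> \oo)
  (tau : nat -> R) (T K : nat -> nat)
  (tau_gt0 : forall l, 0 < tau l)
  (T_gt0 : forall l, (0 < T l)%N)
  (K_gt0 : forall l, (0 < K l)%N)
  (htau : forall l,
    tau l <= cslack P * sigma l ^+ 2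
             / (36 * boundX P * (J l)%:R * L0 P * lbar P l2 (J l)))
  (hT : forall l, 9 * M3 P * lbar P l2 (J l) / sigma l ^+ 2 <= (T l)%:R)
  (hK : forall l,
    2 * ln (sigma l ^+ 2 / (36 * boundY P * lbar P l2 (J l) ^+ 2))
      / ln (1 - mu P / LG P) <= (K l)%:R)
  (xs : nat -> nat -> 'rV[R]_n) (zs : nat -> nat -> nat -> 'rV[R]_m)
  (hrun : forall l,
    procedure_run P (tau l) (J l) (T l) (K l)
      (1 / LG P) (1 / (Lphi P (J l) / 2 + l2)) (xs l) (zs l))
  (t : nat -> nat)
  (ht : forall l, (t l < T l)%N)
  (hFNE : forall l,
    is_FNE P (sigma l) (tau l) (J l) (xs l (t l)) (zs l (t l) (K l)))
  (xbar : 'rV[R]_n) (ybar : 'rV[R]_m)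
  (hcluster : cluster ((xs l (t l), zs l (t l) (K l)) @[l --> \oo]) (xbar, ybar))
  (hint : interior (feasX P) xbar) :
  stationary_point P xbar.
Proof.
have [[[_ Y0] _ [_ cY] [H0 _] _] Xx] := (hsets, interior_subset hint).
have [c0 _ cLH _ _] := hslack.
have L0_gt0 : 0 < L0 P by rewrite -(pmulr_lgt0 _ H0); exact: lt_le_trans cLH.
have [/interior_enormP[r r0 Xr] L1_gt0] := (hint, let: And4 a _ _ _ := hproj in a).
pose x l := xs l (t l); pose y l := zs l (t l) (K l).
have Xxl l : feasX P (x l) by have [[]] := hFNE l.
have Yyl l : feasY P (y l) by have [[]] := hFNE l.
pose w l := tau l / slack P (J l) (x l) (y l).
have s_gt0 l : 0 < slack P (J l) (x l) (y l) by have [] := hFNE l.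
have w_ge0 l : 0 <= w l by rewrite divr_ge0// ltW.
have w_le l : w l * (L0 P * ((J l)%:R + 2)) <= sigma l / (6 * boundX P).
  apply: (@barrier_weight_le _ (cslack P)) (htau l) _ => //.
    by rewrite /lbar le_max /l1 le_max lexx orbT.
  rewrite /x /y; have := hrun l; have := K_gt0 l; case: (K l) => // k _ runl.
  exact: (procedure_slack hsets hlip runl (ht l) (Xxl l)).
(* Smallness of [sigma] and of 1 / J holds on a tail, closeness on a neighbourhood; an accumulation
   point makes the two meet. *)
have approx d : 0 < d -> exists l, [/\ enorm (x l - xbar) < d,
    enorm (y l - ybar) < d, sigma l < d & (J l)%:R^-1 < d].
  move=> d0; pose E := [set l | sigma l < d /\ (J l)%:R^-1 < d].
  have nE : \forall l \near \oo, E l.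
    near=> l; split.
      near: l; move/cvgr_lt : sigma0; exact.
    rewrite invf_plt ?posrE ?ltr0n//.
    apply: lt_le_trans (truncnS_gt d^-1) _; rewrite ler_nat.
    near: l; move/cvgnyPge : Joo; exact.
  have FE : ((x l, y l) @[l --> \oo]) [set (x l, y l) | l in E].
    by apply: filterS nE => l El; exists l.
  have nB : nbhs (xbar, ybar) ([set a | enorm (a - xbar) < d] `*`
                               [set b | enorm (b - ybar) < d]).
    exists ([set a | enorm (a - xbar) < d], [set b | enorm (b - ybar) < d]) => //.
    by split; apply/near_enormP; exists d.
  by have [_ [[l [sl Jl] <-] [/= xl yl]]] := hcluster _ _ FE nB; exists l.
have Yy : feasY P ybar.
  by apply: closed_enorm cY _ => d /approx[l [_ yl _ _]]; exists (y l).
have [sF sf] : twice_cont_diff (prod_set (domC P) (feasY P)) (joint (upper P)) /\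
    twice_cont_diff (prod_set (domC P) (feasY P)) (joint (lower P)).
  by case: hsmooth.
have [lF lf] := let: And4 _ a _ _ := hlip in a.
have h1_ge0 : 0 <= h1 P by case: lF.
have near_bound L d l : 0 <= L -> enorm (x l - xbar) < d ->
    enorm (y l - ybar) < d ->
    L * (enorm (xbar - x l) + enorm (ybar - y l)) <= L * 2 * d.
  move=> L_ge0 xl yl; rewrite -mulrA ler_wpM2l//.
  by rewrite (enorm_distC xbar) (enorm_distC ybar) mulr_natl mulr2n ltW ?ltrD.
have w_le' l : w l <= sigma l * (6 * boundX P * L0 P)^-1.
  rewrite invfM mulrA ler_pdivlMr//; apply: le_trans (w_le l).
  rewrite ler_wpM2l// ler_peMr ?(ltW L0_gt0)//.
  by rewrite -natrD ler1n addn2.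
have dyF0 : dy P (upper P) xbar ybar = 0.
  apply: enorm0_eq0; apply/eqP; rewrite eq_le enorm_ge0 andbT.
  (* Because [d <= 1], [B] bounds the lower-level gradient at every selected iterate, so the barrier
     term is at most a constant times [sigma l]. *)
  pose B := enorm (dy P (lower P) xbar ybar) + L1 P * 2.
  have B_ge0 : 0 <= B by rewrite addr_ge0 ?enorm_ge0 ?mulr_ge0 ?ltW.
  apply: (@le0_of_le_small _ _ (h1 P * 2 + (1 + (6 * boundX P * L0 P)^-1 * B)) 1) => //.
  move=> d d0 d1; have [l [xl yl sl _]] := approx d d0.
  rewrite mulrDl -(subrK (dy P (upper P) (x l) (y l)) (dy P (upper P) xbar ybar)).
  apply: le_trans (enormD _ _) (lerD _ _).
    apply: le_trans (near_bound _ _ l h1_ge0 xl yl).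
    exact: (dy_lipschitz hsets hsmooth hslack hmax sF lF).
  have [_ _ _] := hFNE l; rewrite -/(x l) -/(y l).
  rewrite (dyGE hsets hsmooth hslack hmax)// -/(w l) => dG.
  rewrite -(subrK (w l *: dy P (lower P) (x l) (y l)) (dy P (upper P) (x l) (y l))).
  apply: le_trans (enormD _ _) _; rewrite mulrDl mul1r; apply: lerD.
    exact: le_trans (ltW sl).
  rewrite enormZ ger0_norm// [leRHS]mulrAC; apply: ler_pM; rewrite ?enorm_ge0//.
    apply: le_trans (w_le' l) _; rewrite mulrC ler_pM2l ?invr_gt0 ?mulr_gt0//.
    exact: ltW.
  rewrite -(subrK (dy P (lower P) xbar ybar) (dy P (lower P) (x l) (y l))).
  apply: le_trans (enormD _ _) _; rewrite addrC lerD2l enorm_distC.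
  apply: le_trans (dy_lipschitz hsets hsmooth hslack hmax sf lf _ _ _ _) _ => //.
  apply: le_trans (near_bound _ _ l (ltW L1_gt0) xl yl) _.
  by rewrite ler_piMr// mulr_ge0// ltW.
have dxF0 : dx P (upper P) xbar ybar = 0.
  apply: enorm0_eq0; apply/eqP; rewrite eq_le enorm_ge0 andbT.
  have r2 : 0 < r / 2 by rewrite divr_gt0.
  (* Restricting to [d <= r / 2] keeps a ball of radius r / 2 around [x l] inside [X]. The three
     terms come from Lipschitz continuity, from [first_order_small] and from [w_le]. *)
  apply: (@le0_of_le_small _ _
    (h1 P * 2 + (2 / (r / 2) + (6 * boundX P)^-1)) (r / 2)) => //.
  move=> d d0 dr; have [l [xl yl sl _]] := approx d d0.
  have Xball z : enorm (z - x l) < r / 2 -> feasX P z.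
    move=> zx; apply: Xr; apply: le_lt_trans (enorm_triangle (x l) _ _) _.
    by rewrite [r]splitr ltrD// (lt_le_trans xl).
  have iX : interior (feasX P) (x l) by apply/interior_enormP; exists (r / 2).
  rewrite mulrDl -(subrK (dx P (upper P) (x l) (y l)) (dx P (upper P) xbar ybar)).
  apply: le_trans (enormD _ _) (lerD _ _).
    apply: le_trans (near_bound _ _ l h1_ge0 xl yl).
    exact: (dx_lipschitz hsmooth sF lF).
  have [_ _ + _] := hFNE l; rewrite -/(x l) -/(y l).
  have [u uL ->] := dxGE hsets hsmooth hlip hproj hslack hmax (tau l) iX
    (Yyl l) (s_gt0 l).
  rewrite -/(w l) => /(first_order_small r2 Xball) hv.
  rewrite -(addrK (w l *: u) (dx P (upper P) (x l) (y l))).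
  apply: le_trans (enormB _ _) _; rewrite mulrDl; apply: lerD.
    apply: le_trans hv _; rewrite ler_pM2l ?divr_gt0//; exact: ltW.
  rewrite enormZ ger0_norm// mulrC.
  apply: le_trans (_ : _ <= w l * (L0 P * ((J l)%:R + 2))) _.
    by rewrite mulrC ler_wpM2l.
  apply: le_trans (w_le l) _; rewrite mulrC ler_pM2l ?invr_gt0 ?mulr_gt0//.
  exact: ltW.
have Sybar : Seps P xbar ybar.
  split=> //; rewrite -lerBlDr; apply: lb_le_inf.
    by have [y1 Yy1] := Y0; exists (lower P xbar y1), y1.
  move=> _ [z Yz <-]; rewrite -subr_le0.
  (* The summands pay for moving from [(xbar, ybar)] to the iterate, for moving [x l] back to [xbar]
     at fixed [z], and for the descent rate; positivity of the slack links them. *)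
  apply: (@le0_of_le_small _ _
    (L0 P * 2 + L0 P + 2 * L1 P * boundY P ^+ 2) 1) => //.
  move=> d d0 _; have [l [xl yl _ Jl]] := approx d d0.
  have /(le_trans (ler_norm _))h1 := lower_lipschitz hlip Xx Yy (Xxl l) (Yyl l).
  have h2 := near_bound _ _ l (ltW L0_gt0) xl yl.
  have h3 := s_gt0 l; rewrite /slack in h3.
  have h4 := fJ_rate hsets hsmooth hlip hproj hslack hmax (Xxl l) Yz (hJ l).
  have /(le_trans (ler_norm _))h5 := lower_lipschitz hlip (Xxl l) Yz Xx Yz.
  have h6 : L0 P * (enorm (x l - xbar) + enorm (z - z)) <= L0 P * d.
    by rewrite subrr enorm0 addr0 ler_pM2l// ltW.
  have h7 : 2 * L1 P * boundY P ^+ 2 * (J l)%:R^-1 <= 2 * L1 P * boundY P ^+ 2 * d.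
    by rewrite ler_wpM2l ?(ltW Jl)// mulr_ge0 ?sqr_ge0// mulr_ge0// ltW.
  have := le_trans h1 h2; have := le_trans h5 h6; move: h3 h4 h7.
  move: (fJ P _ _) (lower P (x l) (y l)) (lower P (x l) z) (lower P xbar z)
    (lower P xbar ybar) => a1 a2 a3 a4 a5; clear; lra.
have Rybar : Reps P xbar ybar.
  split=> // z [Yz _]; exact: (upper_maximizer hsets hsmooth hslack hmax).
split=> //.
(* The weights must sum to one even though [lam2] is zero, so one index with [ybar] itself and zero
   multiplier is supplied; its inner condition reduces to [dyF0]. *)
exists ybar, 1, 0, 0, 1%N, 1%N, (fun _ _ => 1), (fun _ _ => 0), (fun=> ybar).
have N0 : normal_cone (feasY P) ybar 0 by move=> z _; rewrite dot0l.
split=> //.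
- by split=> //; [right | case=> /eqP; rewrite oner_eq0].
- by split=> //; rewrite !big_ord1.
- rewrite dxF0 dyF0; split; last by rewrite mul0r.
    by rewrite !scale0r scaler0 !addr0.
  by exists 0 => //; rewrite !scaler0 !scale0r !addr0 subr0.
- move=> i j; rewrite mul0r; split=> //; exists 0 => //.
  by rewrite dyF0 scale0r oppr0 !addr0.
Unshelve. all: by end_near. Qed.
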